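(* There exist absolute constants $\delta>0$ and $C>0$ such that for every prime number $q$, $$\left|\frac{1}{\phi(q-1)}\sum_{\substack{\chi \bmod q\\ \mathrm{ord}(\chi)=q-1}} L(\tfrac12,\chi)\;-\;1\right|\le C(\log q)^{-\delta},$$ where the sum is over all Dirichlet characters $\chi$ modulo $q$ whose order in the group of Dirichlet characters modulo $q$ equals $q-1$.
   Context: $\phi$ is Euler's totient function. $\mathrm{ord}(\chi)$ denotes the order of $\chi$ as an element of the (cyclic, order $q-1$) group of Dirichlet characters modulo $q$; characters with $\mathrm{ord}(\chi)=q-1$ are exactly the generators of this group, and there are $\phi(q-1)$ of them. $L(s,\chi)$ is the Dirichlet $L$-function of $\chi$ (defined by $\sum_{n\ge1}\chi(n)n^{-s}$ for $\Re(s)>1$ and by analytic continuation elsewhere), and $L(\tfrac12,\chi)$ is its value at $s=\tfrac12$. *)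

(* Defs.v *)
From HB Require Import structures.
From mathcomp Require Import all_boot all_order all_algebra.
From mathcomp Require Import all_classical all_reals all_analysis.
From mathcomp Require Import complex.
Set Implicit Arguments.
Unset Strict Implicit.
Unset Printing Implicit Defensive.
Import Order.TTheory GRing.Theory Num.Theory numFieldNormedType.Exports.
Local Open Scope classical_set_scope.
Local Open Scope ring_scope.
Local Open Scope complex_scope.

(* R[i] packaged as a numFieldType, so that it inherits the topology and the
   norm that MathComp-Analysis puts on every numFieldType. *)
Definition Cplx (R : realType) : numFieldType := R[i].

Definition cexp (R : realType) (z : Cplx R) : Cplx R :=
  (expR (complex.Re z))%:C * (cos (complex.Im z) +i* sin (complex.Im z)).

(* f is the sum of a power series centred at z0 on a neighbourhood of z0. *)
Definition analytic_at (K : numFieldType) (f : K -> K) (z0 : K) : Prop :=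
  exists a : nat -> K,
    \forall z \near z0, series (fun n => a n * (z - z0) ^+ n) @ \oo --> f z.

Definition dirichlet_character (R : realType) (q : nat) (chi : int -> Cplx R)
    : Prop :=
  [/\ forall m n : int, chi (m * n) = chi m * chi n,
      forall n : int, chi (n + q%:Z) = chi n
    & forall n : int, chi n != 0 <-> coprimez n q%:Z].

(* The neutral element of the group of Dirichlet characters modulo q, whose
   law is the pointwise product. *)
Definition principal_character (R : realType) (q : nat) : int -> Cplx R :=
  fun n => (coprimez n q%:Z)%:R.

Definition character_has_order (R : realType) (q : nat) (chi : int -> Cplx R)
    (k : nat) : Prop :=
  [/\ (0 < k)%N,
      (fun n => chi n ^+ k) = principal_character R q
    & forall j : nat, (0 < j < k)%N ->
        (fun n => chi n ^+ j) <> principal_character R q].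

(* n^{-s} is exp(- s log n); [series] sums from index 0, hence the shift
   n.+1.  L is the analytic continuation of the Dirichlet series to the whole
   plane, or to the plane minus the pole s = 1 if chi is principal. *)
Definition is_dirichlet_L (R : realType) (q : nat) (chi : int -> Cplx R)
    (L : Cplx R -> Cplx R) : Prop :=
  (forall s : Cplx R, 1 < complex.Re s ->
     series (fun n : nat =>
       chi n.+1%:Z * cexp (- s * (ln (n.+1%:R : R))%:C)) @ \oo --> L s) /\
  (forall s : Cplx R, chi <> principal_character R q \/ s != 1 ->
     analytic_at L s).

(* By the identity theorem, L is determined by [is_dirichlet_L], except for
   its irrelevant value at s = 1 when chi is principal. *)
Definition dirichlet_L (R : realType) (q : nat) (chi : int -> Cplx R)
    : Cplx R -> Cplx R :=
  xget (fun=> 0) [set L | is_dirichlet_L q chi L].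

(* Main.v *)
Require Import Defs.
From mathcomp Require Import all_boot all_order all_algebra.
From mathcomp Require Import cyclic.
From mathcomp Require Import all_classical all_reals all_analysis.
From mathcomp Require Import complex.
From mathcomp Require Import zify ring lra.
Set Implicit Arguments.
Unset Strict Implicit.
Unset Printing Implicit Defensive.

(** Put Q = q - 1 and let c(n) be the average of chi(n) over the characters of
    order Q. It is a Ramanujan sum divided by phi(Q), so |c(n)| <= 1/phi(k) with
    k the order of n modulo q, and c(1) = 1. Repeated summation by parts continues
    L(s, chi) and shows that the average of L(1/2, chi) is the sum of the series
    of c(n) n^(-1/2), which has to be compared with its first term.
    The tail n >= q (by Abel's inequality) and the range q <= n^2 are O(q^(-1/8)),
    because at most k residues satisfy n^k = 1 and the divisor function is small.
    If n^2 < q and n > 1, then n^k > q, that is k log n > log q; multiplying by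
    (k log n / log q)^(1/32) > 1 extracts the saving, and the remaining sum of
    about n^(-15/32) k^(-29/32) is bounded. For k >= n^(5/8) this is clear. For
    k < n^(5/8) one uses that the n with n^2 < q and n^k = 1 are sparse, their
    pairwise products being solutions below q. *)

(** * Divisors and the totient *)

Lemma size_divisorsM (a b : nat) : 0 < a -> 0 < b ->
  size (divisors (a * b)) <= size (divisors a) * size (divisors b).
Proof.
move=> a0 b0; rewrite -(size_allpairs muln).
apply: uniq_leq_size => [|d]; first exact: divisors_uniq.
rewrite -dvdn_divisors ?muln_gt0 ?a0 // => dab.
have g0 : 0 < gcdn d a by rewrite gcdn_gt0 a0 orbT.
apply/allpairsP; exists (gcdn d a, d %/ gcdn d a).
rewrite -!dvdn_divisors //=; split; first exact: dvdn_gcdr.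
  have co : coprime (d %/ gcdn d a) (a %/ gcdn d a).
    by rewrite /coprime -(eqn_pmul2r g0) muln_gcdl !divnK ?mul1n ?dvdn_gcdl ?dvdn_gcdr.
  rewrite -(Gauss_dvdr _ co) -(dvdn_pmul2r g0) divnK ?dvdn_gcdl //.
  by rewrite mulnAC divnK ?dvdn_gcdr.
by rewrite mulnC divnK ?dvdn_gcdl.
Qed.

Lemma size_divisors_pfactor (p a : nat) : prime p ->
  size (divisors (p ^ a)) <= a.+1.
Proof.
move=> pp; rewrite -[leqRHS](size_iota 0) -[leqRHS](size_map (expn p)).
apply: uniq_leq_size => [|d]; first exact: divisors_uniq.
rewrite -dvdn_divisors ?expn_gt0 ?prime_gt0 // => /(dvdn_pfactor _ _ pp)[i ia ->].
by apply: map_f; rewrite mem_iota add0n ltnS.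
Qed.

Lemma succ_exp_le_exp2 (m a : nat) : 0 < m -> a.+1 ^ m <= m ^ m * 2 ^ a.
Proof.
move=> m0; have am : a.+1 <= m * (a %/ m).+1.
  rewrite {1}(divn_eq a m) mulnC mulnS [leqRHS]addnC -addnS leq_add2l.
  by rewrite ltn_mod.
have le1 : a.+1 ^ m <= m ^ m * (a %/ m).+1 ^ m by rewrite -expnMn leq_exp2r.
apply: (leq_trans le1); rewrite leq_pmul2l ?expn_gt0 ?m0 //.
have le2 : (a %/ m).+1 ^ m <= (2 ^ (a %/ m)) ^ m by rewrite leq_exp2r // ltn_expl.
apply: (leq_trans le2); rewrite -expnM leq_exp2l //; exact: leq_divM.
Qed.

Lemma size_divisors_bound (m : nat) : 0 < m ->
  exists2 K : nat, 0 < K &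
    forall N : nat, 0 < N -> size (divisors N) ^ m <= K * N.
Proof.
move=> m0; pose K1 := m ^ m; have K10 : 0 < K1 by rewrite expn_gt0 m0.
exists (K1 ^ (2 ^ m)); first by rewrite expn_gt0 K10.
suff H B N : 0 < N -> (forall p, prime p -> p %| N -> p < B) ->
    size (divisors N) ^ m <= K1 ^ minn B (2 ^ m) * N.
  move=> N N0; apply: (leq_trans (H N.+1 N N0 _)) => [p _ pN|].
    by rewrite ltnS dvdn_leq.
  by rewrite leq_pmul2r // leq_pexp2l // geq_minr.
elim: B N => [|B IH] N N0 HN.
  case: (ltngtP 1 N) => [N1|Nle|<-]; last by rewrite exp1n muln1 expn_gt0 K10.
    by have := HN _ (pdiv_prime N1) (pdiv_dvd N).
  by move: N0 Nle; case: N {HN}.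
have [Bp|Bnp] := boolP (prime B); last first.
  apply: (leq_trans (IH N N0 _)) => [p pp pN|].
    have := HN p pp pN; rewrite ltnS leq_eqVlt => /orP[/eqP pB|//].
    by rewrite -pB pp in Bnp.
  by rewrite leq_pmul2r // leq_pexp2l // leq_min geq_minr (leq_trans (geq_minl _ _)).
have [n Bn NE] := pfactor_coprime Bp N0; set a := logn B N in NE.
have n0 : 0 < n by move: N0; rewrite NE muln_gt0 => /andP[].
have Ba0 : 0 < B ^ a by rewrite expn_gt0 prime_gt0.
have IHn : size (divisors n) ^ m <= K1 ^ minn B (2 ^ m) * n.
  apply: IH => // p pp pn; have pN : p %| N by rewrite NE dvdn_mulr.
  have := HN p pp pN; rewrite ltnS leq_eqVlt => /orP[/eqP pB|//].
  by move: Bn; rewrite -pB prime_coprime // pn.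
have ta : size (divisors (B ^ a)) ^ m <= K1 ^ (B < 2 ^ m) * B ^ a.
  have le1 : size (divisors (B ^ a)) ^ m <= a.+1 ^ m.
    by rewrite leq_exp2r // size_divisors_pfactor.
  apply: (leq_trans le1); case: ltnP => B2 /=.
    rewrite expn1; apply: (leq_trans (succ_exp_le_exp2 _ m0)).
    rewrite leq_pmul2l //; case: (a) => // a'; rewrite leq_exp2r // prime_gt1 //.
  rewrite expn0 mul1n.
  have le2 : a.+1 ^ m <= (2 ^ a) ^ m by rewrite leq_exp2r // ltn_expl.
  apply: (leq_trans le2); rewrite -expnM mulnC expnM.
  by case: (a) => // a'; rewrite leq_exp2r.
have -> : minn B.+1 (2 ^ m) = minn B (2 ^ m) + (B < 2 ^ m).
  by case: ltnP => h; rewrite ?addn1 ?addn0; lia.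
have -> : K1 ^ (minn B (2 ^ m) + (B < 2 ^ m)) * N =
    (K1 ^ minn B (2 ^ m) * n) * (K1 ^ (B < 2 ^ m) * B ^ a).
  by rewrite mulnACA -expnD -NE.
apply: leq_trans (leq_mul IHn ta).
by rewrite -expnMn leq_exp2r // NE size_divisorsM.
Qed.

Lemma totient_mul_dvd (p n : nat) : prime p -> p %| n ->
  totient (p * n) = p * totient n.
Proof.
move=> pp pn; have [->|n0] := posnP n; first by rewrite !muln0.
have [m pm ->] := pfactor_coprime pp n0.
have a0 : 0 < logn p n by rewrite logn_gt0 mem_primes pp n0 pn.
move: (logn p n) a0 => a a0.
have co b : coprime m (p ^ b) by rewrite coprime_sym coprimeXl.
rewrite mulnCA -expnS !totient_coprime // !totient_pfactor //=.
by case: a a0 => // a _; rewrite /= expnS; ring.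
Qed.

Lemma totient_mul_ndvd (p n : nat) : prime p -> ~~ (p %| n) ->
  totient (p * n) = p.-1 * totient n.
Proof.
by move=> pp pn; rewrite totient_coprime ?prime_coprime // totient_prime.
Qed.

Lemma leq_totientMl (m n : nat) : 0 < m -> totient n <= totient (m * n).
Proof.
elim/ltn_ind: m => m IH m0; have [m1|m1] := leqP m 1.
  have -> : m = 1 by apply/eqP; rewrite eqn_leq m1. 
  by rewrite mul1n.
have pp := pdiv_prime m1; have [r rE] := dvdnP (pdiv_dvd m).
move: (pdiv m) pp rE => p pp rE.
have r0 : 0 < r by move: m0; rewrite rE muln_gt0 => /andP[].
have rm : r < m by rewrite rE ltn_Pmulr // prime_gt1.
apply: (leq_trans (IH r rm r0)).
have -> : m * n = p * (r * n) by rewrite rE -mulnA mulnCA.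
have p1 := prime_gt1 pp.
have [pn|pn] := boolP (p %| r * n).
  by rewrite (totient_mul_dvd pp) // leq_pmull // prime_gt0.
by rewrite (totient_mul_ndvd pp) // leq_pmull //; lia.
Qed.

Lemma leq_totient_divisors (n : nat) : 0 < n ->
  n <= totient n * size (divisors n).
Proof.
move=> n0; rewrite -{1}(sum_totient_dvd n).
have le (d : 'I_n.+1) : d %| n -> totient d <= totient n.
  by case/dvdnP=> m nE; rewrite [in leqRHS]nE; apply: leq_totientMl; rewrite lt0n;
  apply: contraTneq n0 => m0; rewrite nE m0.
apply: (@leq_trans (\sum_(d < n.+1 | d %| n) totient n)).
  exact: leq_sum.
rewrite sum_nat_cond_const mulnC leq_mul2l.
apply/orP; right; rewrite cardE -[leqLHS](size_map val).
apply: uniq_leq_size; first by rewrite map_inj_uniq ?enum_uniq //; exact: val_inj.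
move=> d /mapP[e]; rewrite mem_enum => ed ->.
by rewrite inE in ed; rewrite -dvdn_divisors.
Qed.

Import Order.TTheory GRing.Theory Num.Theory numFieldNormedType.Exports.
Local Open Scope classical_set_scope.
Local Open Scope ring_scope.
Local Open Scope complex_scope.

(** * Ramanujan sums *)

Lemma sum_periodic_shift (V : zmodType) (N m : nat) (f : nat -> V) :
  (forall j, f (j + N)%N = f j) ->
  \sum_(0 <= j < N) f (j + m)%N = \sum_(0 <= j < N) f j.
Proof.
move=> fN; elim: m => [|m IH].
  by under eq_bigr => j _ do rewrite addn0.
rewrite -{}IH; case: N fN => [|N] fN; first by rewrite !big_geq.
rewrite big_nat_recr //= [RHS]big_nat_recl //= add0n addrC; congr (_ + _).
  by rewrite addnS -addSn addnC fN.
by apply: eq_bigr => j _; rewrite addnS addSn.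
Qed.

Definition ramanujan_sum (C : pzSemiRingType) (n : nat) (z : C) : C :=
  \sum_(0 <= j < n | coprime j n) z ^+ j.

Lemma ramanujan_sum_dvd (C : idomainType) (p m : nat) (z : C) :
  z ^+ (p * m) = 1 ->
  \sum_(0 <= j < p * m | coprime j m) z ^+ j =
    if z ^+ m == 1 then p%:R * ramanujan_sum m z else 0.
Proof.
move=> zpm; rewrite big_mkcond /=.
pose f j := if coprime j m then z ^+ j else 0.
have cop j t : coprime (j + t * m) m = coprime j m.
  by rewrite -coprime_modl addnC modnMDl coprime_modl.
have [zm|zm] := eqVneq (z ^+ m) 1; last first.
  apply/eqP; have copm j : coprime (j + m) m = coprime j m.
    by rewrite -[X in (j + X)%N]mul1n cop.
  have H : z ^+ m * \sum_(0 <= j < p * m) f j = \sum_(0 <= j < p * m) f j.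
    rewrite -[RHS](@sum_periodic_shift _ _ m) => [|j].
      rewrite mulr_sumr; apply: eq_bigr => j _; rewrite /f copm.
      by case: ifP; rewrite ?mulr0 // exprD mulrC.
    by rewrite /f cop exprD zpm mulr1.
  have /eqP : (z ^+ m - 1) * \sum_(0 <= j < p * m) f j = 0.
    by rewrite mulrBl mul1r H subrr.
  by rewrite mulf_eq0 subr_eq0 (negbTE zm).
elim: p {zpm} => [|p IH]; first by rewrite mul0n big_geq // mul0r.
rewrite mulSn addnC (big_cat_nat _ (leq_addr m (p * m))) //= IH -addn1 natrD mulrDl mul1r.
congr (_ + _); rewrite -{1}[(p * m)%N]add0n big_addn addKn /ramanujan_sum.
rewrite [RHS]big_mkcond /=; apply: eq_bigr => j _; rewrite cop; case: ifP => // _.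
by rewrite exprD mulnC exprM zm expr1n mulr1.
Qed.

(* Induction on n, removing a prime p that divides the order k. *)
Lemma norm_ramanujan_sum (C : numFieldType) (n k : nat) (z : C) :
  (0 < n)%N -> (k %| n)%N -> k.-primitive_root z ->
  `|ramanujan_sum n z| * (totient k)%:R <= (totient n)%:R.
Proof.
elim/ltn_ind: n k z => n IH k z n0 kn zk.
have zn : z ^+ n = 1 by apply/eqP; rewrite -(prim_order_dvd zk).
have [k1|k1] := leqP k 1.
  have kE : k = 1%N by apply/eqP; rewrite eqn_leq k1 (prim_order_gt0 zk).
  have z1 : z = 1 by rewrite -(prim_expr_order zk) kE expr1.
  rewrite kE mulr1 /ramanujan_sum z1 totient_count_coprime natr_sum.
  rewrite (le_trans (ler_norm_sum _ _ _)) // big_mkcond /=.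
  by apply: ler_sum => j _; rewrite coprime_sym; case: coprime; rewrite // expr1n normr1.
have pp := pdiv_prime k1; have pk := pdiv_dvd k; move: (pdiv k) pp pk => p pp pk.
have [m nE] := dvdnP (dvdn_trans pk kn); rewrite mulnC in nE.
have m0 : (0 < m)%N by move: n0; rewrite nE muln_gt0 => /andP[].
have mn : (m < n)%N by rewrite nE ltn_Pmull // prime_gt1.
have zpm : z ^+ (p * m) = 1 by rewrite -nE.
have [pm|pm] := boolP (p %| m)%N.
  have -> : ramanujan_sum n z = \sum_(0 <= j < p * m | coprime j m) z ^+ j.
    rewrite nE; apply: eq_bigl => j; rewrite coprimeMr.
    case: (boolP (coprime j m)); rewrite ?andbF ?andbT // => jm.
    exact: coprime_dvdr jm.
  rewrite ramanujan_sum_dvd //; case: ifP => zm; last by rewrite normr0 mul0r.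
  rewrite normrM normr_nat -mulrA nE totient_mul_dvd // natrM ler_pM2l ?ltr0n ?prime_gt0 //.
  by apply: IH => //; rewrite (prim_order_dvd zk).
have zm : z ^+ m != 1.
  by rewrite -(prim_order_dvd zk); apply: contra pm; apply: dvdn_trans.
have -> : ramanujan_sum n z = - ramanujan_sum m (z ^+ p).
  apply/eqP; rewrite -addr_eq0; apply/eqP.
  have := ramanujan_sum_dvd zpm; rewrite (negbTE zm) => <-.
  rewrite (bigID (fun j => p %| j)%N) /= addrC nE; congr (_ + _).
    by apply: eq_bigl => j; rewrite coprimeMr [coprime j p]coprime_sym prime_coprime // andbC.
  have -> : \sum_(0 <= j < p * m | coprime j m && (p %| j)%N) z ^+ j =
      \sum_(j <- [seq (p * i)%N | i <- index_iota 0 m] | coprime j m) z ^+ j.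
    rewrite -[LHS]big_filter -[RHS]big_filter; apply: perm_big.
    have p0 := prime_gt0 pp.
    apply: uniq_perm.
    - by rewrite filter_uniq // iota_uniq.
    - rewrite filter_uniq // map_inj_uniq ?iota_uniq // => i j /eqP.
      by rewrite eqn_pmul2l // => /eqP.
    move=> j; rewrite !mem_filter mem_index_iota /=; case: coprime => //=.
    apply/andP/mapP => [ [/dvdnP[i ->] ij] | [i ]].
      exists i; last by rewrite mulnC.
      by rewrite mem_index_iota /=; rewrite mulnC ltn_pmul2l in ij.
    by rewrite mem_index_iota /= => im ->; rewrite dvdn_mulr // ltn_pmul2l.
  rewrite big_map /ramanujan_sum; apply: eq_big => [i|i _]; last by rewrite exprM.
  by rewrite coprimeMl (prime_coprime m pp) pm.
have pk' : ~~ (p %| k %/ p)%N.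
  apply: contra pm => h; rewrite -(Gauss_dvdr m (_ : coprime p 1)) ?coprimen1 // mul1n.
  apply: (dvdn_trans h).
  by rewrite -(dvdn_pmul2l (prime_gt0 pp)) -nE mulnC divnK.
have kE : k = (p * (k %/ p))%N by rewrite mulnC divnK.
rewrite normrN {1}kE totient_mul_ndvd // natrM nE totient_mul_ndvd // natrM.
rewrite mulrCA ler_wpM2l ?ler0n //.
apply: IH => //; first by rewrite -(dvdn_pmul2l (prime_gt0 pp)) -nE -kE.
have := exp_prim_root zk p; suff -> : gcdn p k = p by [].
by apply/gcdn_idPl.
Qed.

(** * Complex sequences and series *)

Definition cmod (R : realType) (z : Cplx R) : R := complex.Re `|z|.

Lemma cmodE (R : realType) (z : Cplx R) : `|z| = (cmod z)%:C.
Proof. by rewrite /cmod; apply/esym/RRe_real/normr_real. Qed.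

Lemma cmodEsqrt (R : realType) (z : Cplx R) :
  cmod z = Num.sqrt (complex.Re z ^+ 2 + complex.Im z ^+ 2).
Proof. by rewrite /cmod normc_def. Qed.

Lemma cmod0 (R : realType) : cmod (0 : Cplx R) = 0.
Proof. by rewrite /cmod normr0. Qed.

Lemma cmod1 (R : realType) : cmod (1 : Cplx R) = 1.
Proof. by rewrite /cmod normr1. Qed.

Lemma cmod_ge0 (R : realType) (z : Cplx R) : 0 <= cmod z.
Proof. by rewrite cmodEsqrt sqrtr_ge0. Qed.

Lemma cmodM (R : realType) (y z : Cplx R) : cmod (y * z) = cmod y * cmod z.
Proof. by apply: complexI; rewrite -cmodE normrM !cmodE rmorphM. Qed.

Lemma cmodX (R : realType) (z : Cplx R) n : cmod (z ^+ n) = cmod z ^+ n.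
Proof. by elim: n => [|n IH]; rewrite ?cmod1 // !exprS cmodM IH. Qed.

Lemma cmodN (R : realType) (z : Cplx R) : cmod (- z) = cmod z.
Proof. by rewrite /cmod normrN. Qed.

Lemma cmodD (R : realType) (y z : Cplx R) : cmod (y + z) <= cmod y + cmod z.
Proof. by rewrite -lecR -cmodE rmorphD /= -!cmodE ler_normD. Qed.

Lemma cmodB (R : realType) (y z : Cplx R) : cmod (y - z) <= cmod y + cmod z.
Proof. by rewrite -[in leRHS](cmodN z) cmodD. Qed.

Lemma cmod_distC (R : realType) (y z : Cplx R) : cmod (y - z) = cmod (z - y).
Proof. by rewrite -cmodN opprB. Qed.

Lemma cmod_real (R : realType) (x : R) : cmod (x%:C : Cplx R) = `|x|.
Proof. by rewrite cmodEsqrt /= expr0n addr0 sqrtr_sqr. Qed.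

Lemma cmodV (R : realType) (z : Cplx R) : cmod z^-1 = (cmod z)^-1.
Proof. by apply: complexI; rewrite -cmodE normfV cmodE fmorphV. Qed.

Lemma cmod_eq0 (R : realType) (z : Cplx R) : (cmod z == 0) = (z == 0).
Proof.
rewrite -[RHS]normr_eq0 cmodE; apply/eqP/eqP => [->//|]; exact: (@complexI R).
Qed.

Lemma cmod_nat (R : realType) n : cmod (n%:R : Cplx R) = n%:R.
Proof.
rewrite -[n%:R in LHS](_ : (n%:R : R)%:C = _); first by rewrite cmod_real normr_nat.
by rewrite rmorph_nat.
Qed.

Lemma cmod_sum (R : realType) (I : Type) (r : seq I) (P : pred I)
  (u : I -> Cplx R) :
  cmod (\sum_(i <- r | P i) u i) <= \sum_(i <- r | P i) cmod (u i).
Proof.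
elim/big_rec2: _ => [|i y1 y2 _ h]; first by rewrite cmod0.
by rewrite (le_trans (cmodD _ _)) // lerD2l.
Qed.

Lemma ReD (R : realType) (y z : Cplx R) : complex.Re (y + z) = complex.Re y + complex.Re z.
Proof. by case: y; case: z. Qed.

Lemma ImD (R : realType) (y z : Cplx R) : complex.Im (y + z) = complex.Im y + complex.Im z.
Proof. by case: y; case: z. Qed.

Lemma ReN (R : realType) (z : Cplx R) : complex.Re (- z) = - complex.Re z.
Proof. by case: z. Qed.

Lemma ImN (R : realType) (z : Cplx R) : complex.Im (- z) = - complex.Im z.
Proof. by case: z. Qed.

Lemma Re_sum (R : realType) (I : Type) (r : seq I) (P : pred I) (u : I -> Cplx R) :
  complex.Re (\sum_(i <- r | P i) u i) = \sum_(i <- r | P i) complex.Re (u i).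
Proof. by elim/big_rec2: _ => [//|i y1 y2 _ <-]; rewrite ReD. Qed.

Lemma Im_sum (R : realType) (I : Type) (r : seq I) (P : pred I) (u : I -> Cplx R) :
  complex.Im (\sum_(i <- r | P i) u i) = \sum_(i <- r | P i) complex.Im (u i).
Proof. by elim/big_rec2: _ => [//|i y1 y2 _ <-]; rewrite ImD. Qed.

Lemma ler_Re_cmod (R : realType) (z : Cplx R) : `|complex.Re z| <= cmod z.
Proof. by rewrite cmodEsqrt -sqrtr_sqr ler_wsqrtr // lerDl sqr_ge0. Qed.

Lemma ler_Im_cmod (R : realType) (z : Cplx R) : `|complex.Im z| <= cmod z.
Proof. by rewrite cmodEsqrt -sqrtr_sqr ler_wsqrtr // lerDr sqr_ge0. Qed.

Lemma ler_cmod_ReIm (R : realType) (z : Cplx R) :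
  cmod z <= `|complex.Re z| + `|complex.Im z|.
Proof.
set a := `|_|; set b := `|_|.
have -> : a + b = Num.sqrt ((a + b) ^+ 2).
  by rewrite sqrtr_sqr ger0_norm // addr_ge0 // normr_ge0.
rewrite cmodEsqrt ler_wsqrtr // {}/a {}/b.
by rewrite sqrrD !real_normK ?num_real // -addrA lerD2l lerDr mulrn_wge0 // mulr_ge0.
Qed.

Lemma cvgC0P (R : realType) (u : nat -> Cplx R) (l : Cplx R) :
  (u @ \oo --> l) <-> ((fun n => cmod (u n - l)) @ \oo --> (0 : R)).
Proof.
split => [/cvgrPdist_lt h|/cvgrPdist_lt h]; apply/cvgrPdist_lt => e e0.
  have := h e%:C; rewrite -[0 < e%:C]/(0%:C < e%:C) ltcR => /(_ e0).
  apply: filterS => n; rewrite cmodE ltcR sub0r normrN ger0_norm ?cmod_ge0 //.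
  by rewrite cmod_distC.
have [r eE] : exists r : R, e = r%:C.
  by exists (complex.Re e); apply/esym/RRe_real/gtr0_real.
have r0 : 0 < r by move: e0; rewrite eE -[0 < r%:C]/(0%:C < r%:C) ltcR.
have := h r r0; apply: filterS => n; rewrite eE cmodE ltcR.
by rewrite sub0r normrN ger0_norm ?cmod_ge0 // cmod_distC.
Qed.

Lemma cvgC_squeeze (R : realType) (u : nat -> Cplx R) (l : Cplx R) (v : nat -> R) :
  (forall n, cmod (u n - l) <= v n) -> v @ \oo --> (0 : R) -> u @ \oo --> l.
Proof.
move=> uv v0; apply/cvgC0P; apply: (@squeeze_cvgr _ _ _ _ (fun=> 0) v) => //.
  by apply: nearW => n; rewrite cmod_ge0 uv.
exact: cvg_cst.
Qed.

Lemma cvg_ReIm (R : realType) (u : nat -> Cplx R) (a b : R) :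
  (fun n => complex.Re (u n)) @ \oo --> a ->
  (fun n => complex.Im (u n)) @ \oo --> b ->
  u @ \oo --> (a +i* b : Cplx R).
Proof.
move=> ha hb; apply: (@cvgC_squeeze _ _ _
   (fun n => `|complex.Re (u n) - a| + `|complex.Im (u n) - b|)).
  move=> n; apply: le_trans (ler_cmod_ReIm _) _.
  by rewrite ReD ImD ReN ImN.
have dist0 (v : nat -> R) c : v @ \oo --> c -> (fun n => `|v n - c|) @ \oo --> (0 : R).
  by move=> vc; apply/norm_cvg0P; rewrite -(subrr c); apply: cvgB => //; exact: cvg_cst.
by rewrite -[X in _ --> X](addr0 (0 : R)); apply: cvgD; exact: dist0.
Qed.

Lemma cmod_cvg_le (R : realType) (u : nat -> Cplx R) (l : Cplx R) (B : R) :
  u @ \oo --> l -> (forall n, cmod (u n) <= B) -> cmod l <= B.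
Proof.
move=> /cvgC0P ul uB; apply/ler_addgt0Pr => e e0.
move: (ul) => /cvgrPdist_lt /(_ e e0) [N _ /(_ N (leqnn N))].
rewrite /= sub0r normrN ger0_norm ?cmod_ge0 // => h.
rewrite -[l](subrK (u N)) addrC (le_trans (cmodD _ _)) // lerD //.
by rewrite cmod_distC ltW.
Qed.

Lemma abs_series_cvg (R : realType) (u : nat -> Cplx R) (B : R) :
  (forall N, \sum_(0 <= n < N) cmod (u n) <= B) ->
  exists2 l : Cplx R, series u @ \oo --> l & cmod l <= B.
Proof.
move=> uB.
have real_cvg (v : nat -> R) : (forall n, `|v n| <= cmod (u n)) -> cvgn (series v).
  move=> vu; apply: normed_cvg; apply: nondecreasing_is_cvgn.
    by apply/nondecreasing_seqP => n; rewrite -subr_ge0 seriesSB /=.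
  exists B => _ [n _ <-]; apply: le_trans (uB n); rewrite /series /=.
  by apply: ler_sum.
have /cvg_ex[a ha] := real_cvg _ (fun n => ler_Re_cmod (u n)).
have /cvg_ex[b hb] := real_cvg _ (fun n => ler_Im_cmod (u n)).
have ul : series u @ \oo --> (a +i* b : Cplx R).
  apply: cvg_ReIm.
    by rewrite (_ : (fun n => _) = series (fun n => complex.Re (u n))) //;
       apply/funext => n; rewrite /series /= Re_sum.
  by rewrite (_ : (fun n => _) = series (fun n => complex.Im (u n))) //;
     apply/funext => n; rewrite /series /= Im_sum.
exists (a +i* b) => //; apply: cmod_cvg_le ul _ => n.
exact: le_trans (cmod_sum _ _ _) (uB n).
Qed.

(** * The complex exponential *)

Definition exp_sum (K : fieldType) (x : K) (N : nat) : K :=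
  \sum_(0 <= n < N) x ^+ n / n`!%:R.

Lemma sum_triangle (V : zmodType) (g : nat -> nat -> V) (N : nat) :
  \sum_(0 <= n < N) \sum_(0 <= i < n.+1) g i (n - i)%N =
  \sum_(0 <= i < N) \sum_(0 <= j < N - i) g i j.
Proof.
elim: N => [|N IH]; first by rewrite !big_geq.
rewrite big_nat_recr //= IH [RHS]big_nat_recr //= subSnn big_nat1.
rewrite [X in _ + X]big_nat_recr //= subnn addrA; congr (_ + _).
rewrite -big_split /= [LHS]big_nat_cond [RHS]big_nat_cond; apply: eq_bigr => i.
by rewrite andbT => /andP[_ iN]; rewrite subSn ?(ltnW iN) // big_nat_recr.
Qed.

Lemma exp_sumD (K : numFieldType) (x y : K) (N : nat) :
  exp_sum x N * exp_sum y N - exp_sum (x + y) N =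
  \sum_(0 <= i < N) \sum_(N - i <= j < N) (x ^+ i / i`!%:R) * (y ^+ j / j`!%:R).
Proof.
have -> : exp_sum (x + y) N =
   \sum_(0 <= n < N) \sum_(0 <= i < n.+1)
      (x ^+ i / i`!%:R) * (y ^+ (n - i) / (n - i)`!%:R).
  apply: eq_bigr => n _; rewrite addrC exprDn mulr_suml big_mkord.
  apply: eq_bigr => i _; have iN : (i <= n)%N by rewrite -ltnS ltn_ord.
  have nz k : k`!%:R != 0 :> K by rewrite pnatr_eq0 -lt0n fact_gt0.
  rewrite -(bin_fact iN) !natrM -mulr_natr; field.
  by rewrite !nz pnatr_eq0 -lt0n bin_gt0 iN.
rewrite (sum_triangle (fun i j => (x ^+ i / i`!%:R) * (y ^+ j / j`!%:R))).
rewrite /exp_sum mulr_suml -sumrB; apply: eq_bigr => i _.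
rewrite mulr_sumr (big_cat_nat (leq0n (N - i)) (leq_subr i N)) /=.
by rewrite addrAC subrr add0r.
Qed.

Lemma cmod_exp_sumD (R : realType) (x y : Cplx R) (N : nat) :
  cmod (exp_sum x N * exp_sum y N - exp_sum (x + y) N) <=
  exp_sum (cmod x) N * exp_sum (cmod y) N - exp_sum (cmod x + cmod y) N.
Proof.
rewrite !exp_sumD (le_trans (cmod_sum _ _ _)) //; apply: ler_sum => i _.
rewrite (le_trans (cmod_sum _ _ _)) //; apply: ler_sum => j _.
by rewrite !cmodM !cmodV !cmodX !cmod_nat.
Qed.

Lemma exp_sum_expR (R : realType) (x : R) : exp_sum x @ \oo --> expR x.
Proof. exact: is_cvg_series_exp_coeff. Qed.

Lemma expr_imaginary (R : realType) (y : R) (n : nat) :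
  (0 +i* y : Cplx R) ^+ n / n`!%:R = cos_coeff y n +i* sin_coeff y n.
Proof.
have e2 m : (0 +i* y : Cplx R) ^+ m.*2 = ((-1) ^+ m * y ^+ m.*2)%:C.
  have -> : (0 +i* y : Cplx R) ^+ m.*2 = (- (y ^+ 2))%:C ^+ m.
    rewrite -mul2n exprM; congr (_ ^+ _); rewrite expr2.
    by apply/eqP; rewrite eq_complex /=; apply/andP; split; apply/eqP; ring.
  rewrite -rmorphXn; congr (_%:C).
  by rewrite [LHS]exprNn -exprM mul2n.
have -> : (n`!%:R : Cplx R) = (n`!%:R : R)%:C by rewrite rmorph_nat.
rewrite -fmorphV -[in (_ +i* y) ^+ n](odd_double_half n) exprD e2.
rewrite /cos_coeff /sin_coeff /=.
have h : (n = odd n + n./2.*2)%N by rewrite odd_double_half.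
case: (boolP (odd n)) h => /= on h.
  rewrite expr1 mul0r mul1r; have -> : n.-1./2 = n./2.
    by rewrite h /= add0n doubleK uphalf_double.
  have -> : y ^+ n = y * y ^+ n./2.*2 by rewrite {1}h exprD.
  by apply/eqP; rewrite eq_complex /=;
     apply/andP; split; apply/eqP; ring.
have -> : y ^+ n = y ^+ n./2.*2 by rewrite {1}h.
rewrite expr0 !mul1r !mul0r -exprnP.
by apply/eqP; rewrite eq_complex /=; apply/andP; split; apply/eqP; ring.
Qed.

Lemma cexpE (R : realType) (x y : R) :
  cexp (x +i* y : Cplx R) = (expR x)%:C * (cos y +i* sin y).
Proof. by []. Qed.

Lemma exp_sum_cexp (R : realType) (z : Cplx R) : exp_sum z @ \oo --> cexp z.
Proof.
case: z => x y; rewrite cexpE.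
have -> : (x +i* y : Cplx R) = (x%:C : Cplx R) + (0 +i* y : Cplx R).
  by apply/eqP; rewrite eq_complex /= addr0 add0r !eqxx.
have hx : exp_sum (x%:C : Cplx R) @ \oo --> ((expR x)%:C : Cplx R).
  apply: (@cvgC_squeeze _ _ _ (fun n => `|exp_sum x n - expR x|)) => [n|].
    rewrite -cmod_real rmorphB /=; suff -> : (exp_sum x n)%:C = exp_sum (x%:C : Cplx R) n by [].
    rewrite /exp_sum rmorph_sum; apply: eq_bigr => i _.
    by rewrite rmorphM /= fmorphV rmorphXn rmorph_nat.
  by apply/norm_cvg0P; rewrite -(subrr (expR x)); apply: cvgB; [exact: exp_sum_expR|exact: cvg_cst].
have hy : exp_sum (0 +i* y : Cplx R) @ \oo --> (cos y +i* sin y : Cplx R).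
  apply: cvg_ReIm.
    rewrite [X in X @ _ --> _](_ : _ = series (cos_coeff y)).
      by rewrite cos.unlock; exact: is_cvg_series_cos_coeff.
    by apply/funext => n; rewrite /exp_sum Re_sum; apply: eq_bigr => i _; rewrite expr_imaginary.
  rewrite [X in X @ _ --> _](_ : _ = series (sin_coeff y)).
    by rewrite sin.unlock; exact: is_cvg_series_sin_coeff.
  by apply/funext => n; rewrite /exp_sum Im_sum; apply: eq_bigr => i _; rewrite expr_imaginary.
set a : Cplx R := x%:C; set b : Cplx R := 0 +i* y.
have h : (fun N => exp_sum a N * exp_sum b N - exp_sum (a + b) N) @ \oo --> (0 : Cplx R).
  apply: (@cvgC_squeeze _ _ _ _).
    by move=> n; rewrite subr0; exact: cmod_exp_sumD.
  rewrite -(subrr (expR (cmod a + cmod b))) {1}expRD; apply: cvgB; last exact: exp_sum_expR.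
  by apply: cvgM; exact: exp_sum_expR.
rewrite [X in X @ _ --> _](_ : _ = (fun N => exp_sum a N * exp_sum b N -
   (exp_sum a N * exp_sum b N - exp_sum (a + b) N))); last first.
  by apply/funext => N; rewrite subKr.
have hab : (fun N => exp_sum a N * exp_sum b N) @ \oo -->
  ((expR x)%:C * (cos y +i* sin y) : Cplx R) by exact: cvgM hx hy.
have : (fun N => exp_sum a N * exp_sum b N - (exp_sum a N * exp_sum b N -
    exp_sum (a + b) N)) @ \oo --> ((expR x)%:C * (cos y +i* sin y) - 0 : Cplx R).
  exact: cvgB hab h.
by rewrite subr0.
Qed.

Lemma cmod_cexp (R : realType) (z : Cplx R) : cmod (cexp z) = expR (complex.Re z).
Proof.
case: z => x y; rewrite cexpE cmodM cmod_real ger0_norm ?expR_ge0 //=.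
by rewrite cmodEsqrt /= cos2Dsin2 sqrtr1 mulr1.
Qed.

Lemma cexpD (R : realType) (y z : Cplx R) : cexp (y + z) = cexp y * cexp z.
Proof.
case: y z => [a b] [c d]; rewrite !cexpE expRD cosD sinD.
by apply/eqP; rewrite eq_complex /=; apply/andP; split; apply/eqP; ring.
Qed.

Lemma cexp_real (R : realType) (x : R) : cexp (x%:C : Cplx R) = (expR x)%:C.
Proof. by rewrite cexpE cos0 sin0 complexr0 mulr1. Qed.

(** * Power series *)

Lemma cexp_imaginaryX (R : realType) (y : R) (k : nat) :
  cexp (0 +i* y : Cplx R) ^+ k = cexp (0 +i* (k%:R * y) : Cplx R).
Proof.
elim: k => [|k IH]; first by rewrite expr0 mul0r cexp_real expR0.
rewrite exprS IH -cexpD; congr cexp; apply/eqP.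
by rewrite eq_complex /= addr0 eqxx /= -addn1 natrD; apply/eqP; ring.
Qed.

Lemma prim_root_exists (R : realType) (n : nat) : (0 < n)%N ->
  exists z : Cplx R, n.-primitive_root z.
Proof.
move=> n0; exists (cexp (0 +i* (pi *+ 2 / n%:R))).
have nR0 : (n%:R : R) != 0 by rewrite pnatr_eq0 -lt0n.
apply/andP; split=> //; apply/forallP => i; apply/eqP.
rewrite unity_rootE cexp_imaginaryX cexpE expR0 mul1r.
have [->|ne] := eqVneq i.+1 n.
  by rewrite mulrCA mulfV // mulr1 cos2pi sin2pi eqxx.
have iN : (i.+1 < n)%N by rewrite ltn_neqAle ne ltn_ord.
apply/negbTE/negP => /eqP[cE _].
have sx : 0 < sin (pi * (i.+1%:R / n%:R) : R).
  apply: sin_gt0_pi; rewrite mulr_gt0 ?pi_gt0 ?divr_gt0 ?ltr0n //=.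
  by rewrite gtr_pMr ?pi_gt0 // ltr_pdivrMr ?ltr0n // mul1r ltr_nat.
have : cos (pi * (i.+1%:R / n%:R) *+ 2 : R) = 1.
  by rewrite -[RHS]cE; congr cos; ring.
rewrite cos_mulr2n; have := cos2Dsin2 (pi * (i.+1%:R / n%:R) : R).
have : 0 < sin (pi * (i.+1%:R / n%:R) : R) ^+ 2 by rewrite exprn_gt0.
lra.
Qed.

Lemma cmod_unity_root (R : realType) (n : nat) (z : Cplx R) :
  (0 < n)%N -> z ^+ n = 1 -> cmod z = 1.
Proof.
move=> n0 zn; apply/eqP; rewrite -(@pexpr_eq1 _ (cmod z) n) ?cmod_ge0 //.
by rewrite -cmodX zn cmod1.
Qed.

Lemma cvg_series_terms_bounded (R : realType) (u : nat -> Cplx R) (l : Cplx R) :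
  series u @ \oo --> l -> exists2 K : R, 0 <= K & forall n, cmod (u n) <= K.
Proof.
move=> /cvgC0P ul.
have [K hK] : exists K : R, forall n, cmod (series u n - l) <= K.
  move: (ul) => /cvgrPdist_lt /(_ 1 ltr01) [N _ hN].
  exists (1 + \sum_(0 <= n < N) cmod (series u n - l)) => n.
  have [nN|nN] := ltnP n N.
    rewrite (bigD1_seq n) ?iota_uniq ?mem_index_iota //= addrCA lerDl addr_ge0 //.
    by apply: sumr_ge0 => i _; exact: cmod_ge0.
  rewrite -[leLHS]addr0 lerD //; last by apply: sumr_ge0 => i _; exact: cmod_ge0.
  by have /= := hN n nN; rewrite sub0r normrN ger0_norm ?cmod_ge0 // => /ltW.
have K0 : 0 <= K by apply: le_trans (hK 0%N); exact: cmod_ge0.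
exists (K + K) => [|n]; first exact: addr_ge0.
have -> : u n = (series u n.+1 - l) - (series u n - l).
  by rewrite opprB addrA subrK seriesSB.
by rewrite (le_trans (cmodB _ _)) // lerD.
Qed.

Lemma sum_geometric_le (R : realType) (rho : R) (N n : nat) : 0 <= rho <= 2^-1 ->
  \sum_(N <= i < N + n) rho ^+ i <= 2 * rho ^+ N.
Proof.
move=> /andP[r0 r2].
suff : \sum_(N <= i < N + n) rho ^+ i <= 2 * rho ^+ N - 2 * rho ^+ (N + n).
  by move=> h; apply: (le_trans h); rewrite gerBl mulr_ge0 ?exprn_ge0.
elim: n => [|n IH]; first by rewrite addn0 subrr big_geq.
rewrite addnS big_nat_recr ?leq_addr //=.
rewrite (le_trans (lerD IH (lexx _))) // exprS.
have : rho * rho ^+ (N + n) <= 2^-1 * rho ^+ (N + n).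
  by rewrite ler_wpM2r // exprn_ge0.
lra.
Qed.

Lemma series_tail_le (R : realType) (u : nat -> Cplx R) (l : Cplx R) (K rho : R) (N : nat) :
  0 <= K -> 0 <= rho <= 2^-1 -> (forall i, cmod (u i) <= K * rho ^+ i) ->
  series u @ \oo --> l -> cmod (l - series u N) <= K * (2 * rho ^+ N).
Proof.
move=> K0 hr hu ul.
have hs : (fun n => series u (n + N)%N - series u N) @ \oo --> l - series u N.
  by apply: cvgB; [rewrite cvg_shiftn|exact: cvg_cst].
apply: (cmod_cvg_le hs) => n.
rewrite addnC sub_series_geq ?leq_addr // (le_trans (cmod_sum _ _ _)) //.
apply: (@le_trans _ _ (\sum_(N <= i < N + n) K * rho ^+ i)); first exact: ler_sum.
by rewrite -mulr_sumr ler_wpM2l // sum_geometric_le.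
Qed.

Lemma geometric_half_cvg0 (R : realType) (K : R) :
  (fun n => K * (2 * 2^-1 ^+ n)) @ \oo --> (0 : R).
Proof.
have h : geometric (K * 2) 2^-1 @ \oo --> (0 : R).
  by apply: cvg_geometric; rewrite ger0_norm ?invr_ge0 // invf_lt1 // ltr1n.
by rewrite (_ : (fun n => _) = geometric (K * 2) 2^-1) //; apply/funext => n; rewrite /= mulrA.
Qed.

Lemma sum_root_powers (C : fieldType) (N : nat) (z : C) (i : nat) : (0 < N)%N ->
  N.-primitive_root z ->
  \sum_(0 <= j < N) z ^+ (i * j) = if (N %| i)%N then N%:R else 0.
Proof.
move=> N0 zN; rewrite (prim_order_dvd zN).
under eq_bigr => j _ do rewrite exprM.
have [->|h] := eqVneq (z ^+ i) 1.
  by under eq_bigr => j _ do rewrite expr1n; rewrite sumr_const_nat subn0.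
apply/eqP; have : (z ^+ i - 1) * \sum_(0 <= j < N) z ^+ i ^+ j == 0.
  by rewrite big_mkord -subrX1 -exprM mulnC exprM (prim_expr_order zN) expr1n subrr.
by rewrite mulf_eq0 subr_eq0 (negbTE h).
Qed.

(* Averaging over the N-th roots of unity of radius r isolates the coefficient
   a_k, since N exceeds all the exponents. *)
Lemma cauchy_estimate_poly (R : realType) (a : nat -> Cplx R) (r B : R) (N k : nat) :
  0 <= r -> (k < N)%N ->
  (forall w, cmod w <= r -> cmod (series (fun i => a i * w ^+ i) N) <= B) ->
  cmod (a k) * r ^+ k <= B.
Proof.
move=> r0 kN hB; have N0 : (0 < N)%N by apply: leq_ltn_trans kN.
have [z zN] := prim_root_exists R N0.
have z1 : cmod z = 1 by apply: (cmod_unity_root N0); exact: prim_expr_order.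
have key : \sum_(0 <= j < N) z ^+ ((N - k) * j) *
      series (fun i => a i * (r%:C * z ^+ j) ^+ i) N = N%:R * (a k * r%:C ^+ k).
  transitivity (\sum_(0 <= j < N) \sum_(0 <= i < N)
      a i * r%:C ^+ i * z ^+ ((i + (N - k)) * j)).
    apply: eq_bigr => j _; rewrite mulr_sumr; apply: eq_bigr => i _.
    by rewrite exprMn mulnDl exprD -exprM [(j * i)%N]mulnC; ring.
  rewrite exchange_big /= (bigD1_seq k) ?iota_uniq ?mem_index_iota //=.
  rewrite [X in _ + X]big1_seq => [|i /andP[ik]].
    rewrite -mulr_sumr sum_root_powers // subnKC ?dvdnn 1?ltnW // addr0; exact: mulrC.
  rewrite mem_index_iota /= => iN; rewrite -mulr_sumr sum_root_powers //.
  rewrite ifF ?mulr0 //; apply/negbTE/negP => /dvdnP[[|[|t]]] h; lia.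
have : cmod (N%:R * (a k * r%:C ^+ k)) <= N%:R * B.
  rewrite -key (le_trans (cmod_sum _ _ _)) //.
  have -> : N%:R * B = \sum_(0 <= j < N) B by rewrite sumr_const_nat subn0 mulr_natl.
  apply: ler_sum => j _; rewrite cmodM cmodX z1 expr1n mul1r; apply: hB.
  by rewrite cmodM cmodX z1 expr1n mulr1 cmod_real ger0_norm.
by rewrite cmodM cmod_nat cmodM cmodX cmod_real ger0_norm // ler_pM2l ?ltr0n.
Qed.

Lemma cauchy_estimate (R : realType) (a : nat -> Cplx R) (f : Cplx R -> Cplx R)
  (r B : R) (k : nat) : 0 < r ->
  (forall w, series (fun i => a i * w ^+ i) @ \oo --> f w) ->
  (forall w, cmod w <= r -> cmod (f w) <= B) ->
  cmod (a k) * r ^+ k <= B.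
Proof.
move=> r0 fs fB.
have [K K0 hK] := cvg_series_terms_bounded (fs (2 * r)%:C).
have rn0 : r != 0 by rewrite gt_eqF.
have term w i : cmod w <= r -> cmod (a i * w ^+ i) <= K * 2^-1 ^+ i.
  move=> wr; apply: (@le_trans _ _ (cmod (a i * (2 * r)%:C ^+ i) * 2^-1 ^+ i)); last first.
    by rewrite ler_wpM2r ?exprn_ge0 ?invr_ge0.
  rewrite !cmodM !cmodX cmod_real ger0_norm ?mulr_ge0 ?(ltW r0) // -mulrA -exprMn.
  rewrite ler_wpM2l ?cmod_ge0 //; apply: lerXn2r; rewrite ?nnegrE ?cmod_ge0 //.
    by rewrite !mulr_ge0 // ?invr_ge0 // ltW.
  by rewrite mulrAC mulfV ?mul1r // pnatr_eq0.
have step N : (k < N)%N -> cmod (a k) * r ^+ k <= B + K * (2 * 2^-1 ^+ N).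
  move=> kN; apply: cauchy_estimate_poly kN _; first exact: ltW.
  move=> w wr; rewrite -[series _ _](subrK (f w)) addrC (le_trans (cmodD _ _)) // lerD ?fB //.
  rewrite cmod_distC; apply: series_tail_le => //; last by move=> i; exact: term.
  by rewrite invr_ge0 ler0n lexx.
have lim : (fun N => B + K * (2 * 2^-1 ^+ N)) @ \oo --> B.
  rewrite -[X in _ --> X]addr0; apply: cvgD; first exact: cvg_cst.
  exact: geometric_half_cvg0.
apply: (ler_cvg_to (cvg_cst _) lim); near=> N; apply: step.
by near: N; exact: nbhs_infty_gt.
Unshelve. all: by end_near. Qed.

(* Fixes one elaboration of the topology on [Cplx R]. *)
Definition ccvg (R : realType) (u : nat -> Cplx R) (l : Cplx R) : Prop :=
  u @ \oo --> l.

Lemma ccvg_cst (R : realType) (l : Cplx R) : ccvg (fun=> l) l.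
Proof. exact: cvg_cst. Qed.

Lemma ccvgD (R : realType) (u v : nat -> Cplx R) (k l : Cplx R) :
  ccvg u k -> ccvg v l -> ccvg (fun n => u n + v n) (k + l).
Proof. by move=> uk vl; exact: cvgD uk vl. Qed.

Lemma ccvgN (R : realType) (u : nat -> Cplx R) (l : Cplx R) :
  ccvg u l -> ccvg (fun n => - u n) (- l).
Proof. by move=> ul; exact: cvgN ul. Qed.

Lemma ccvgB (R : realType) (u v : nat -> Cplx R) (k l : Cplx R) :
  ccvg u k -> ccvg v l -> ccvg (fun n => u n - v n) (k - l).
Proof. by move=> uk /ccvgN; exact: ccvgD. Qed.

Lemma ccvg_mulr (R : realType) (u : nat -> Cplx R) (l c : Cplx R) :
  ccvg u l -> ccvg (fun n => u n * c) (l * c).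
Proof. by move=> ul; exact: cvgM ul (cvg_cst c). Qed.

Lemma ccvg_mull (R : realType) (u : nat -> Cplx R) (l c : Cplx R) :
  ccvg u l -> ccvg (fun n => c * u n) (c * l).
Proof. by move=> ul; exact: cvgM (cvg_cst c) ul. Qed.

Lemma ccvg_sum (R : realType) (I : Type) (r : seq I) (u : I -> nat -> Cplx R)
  (v : I -> Cplx R) : (forall k, ccvg (u k) (v k)) ->
  ccvg (fun N => \sum_(k <- r) u k N) (\sum_(k <- r) v k).
Proof.
move=> uv; elim: r => [|k r IH].
  have -> : (fun N => \sum_(k <- [::]) u k N) = fun=> 0.
    by apply/funext => N; rewrite big_nil.
  by rewrite big_nil; exact: ccvg_cst.
have -> : (fun N => \sum_(k <- k :: r) u k N) = (fun N => u k N + \sum_(k <- r) u k N).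
  by apply/funext => N; rewrite big_cons.
by rewrite big_cons; exact: ccvgD (uv k) IH.
Qed.

Lemma ccvg_unique (R : realType) (u : nat -> Cplx R) (k l : Cplx R) :
  ccvg u k -> ccvg u l -> k = l.
Proof. by move=> uk ul; exact: cvg_unique uk ul. Qed.

Lemma cauchy_term_le (R : realType) (K r : R) (n : nat) (w : Cplx R)
  (a : Cplx R) : 0 < r -> cmod a * r ^+ n <= K -> cmod w <= r / 2 ->
  cmod (a * w ^+ n) <= K * 2^-1 ^+ n.
Proof.
move=> r0 aK wr; rewrite cmodM cmodX.
apply: (@le_trans _ _ (cmod a * (r / 2) ^+ n)).
  rewrite ler_wpM2l ?cmod_ge0 // lerXn2r // nnegrE ?cmod_ge0 //.
  by rewrite divr_ge0 // ltW.
by rewrite exprMn mulrA ler_wpM2r // exprn_ge0 // invr_ge0.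
Qed.

Lemma weierstrass_power_series (R : realType) (a : nat -> nat -> Cplx R)
  (f : nat -> Cplx R -> Cplx R) (b : nat -> R) (r S : R) : 0 < r ->
  (forall n w, series (fun k => a n k * w ^+ k) @ \oo --> f n w) ->
  (forall n w, cmod w <= r -> cmod (f n w) <= b n) ->
  (forall N, \sum_(0 <= n < N) b n <= S) ->
  exists A : nat -> Cplx R, forall w (l : Cplx R), cmod w <= r / 2 ->
    series (fun n => f n w) @ \oo --> l ->
    series (fun k => A k * w ^+ k) @ \oo --> l.
Proof.
move=> r0 af fb bS.
have est n k : cmod (a n k) * r ^+ k <= b n.
  by apply: cauchy_estimate (af n) (fb n).
have b0 n : 0 <= b n.
  by apply: le_trans (est n 0%N); rewrite mulr_ge0 ?cmod_ge0 ?exprn_ge0 // ltW.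
have S0 : 0 <= S by apply: le_trans (bS 0%N); rewrite big_geq.
have ex k : exists A : Cplx R, series (fun n => a n k) @ \oo --> A.
  have [|A hA _] := @abs_series_cvg _ (fun n => a n k) (S / r ^+ k); last by exists A.
  move=> N; apply: (@le_trans _ _ (\sum_(0 <= n < N) b n / r ^+ k)).
    by apply: ler_sum => n _; rewrite ler_pdivlMr ?exprn_gt0.
  by rewrite -mulr_suml ler_wpM2r // invr_ge0 exprn_ge0 // ltW.
have [A hA] := choice ex; exists A => w l wr fl.
have half : 0 <= (2^-1 : R) <= 2^-1 by rewrite invr_ge0 ler0n lexx.
apply: (@cvgC_squeeze _ _ _ (fun K => S * (2 * 2^-1 ^+ K))); last exact: geometric_half_cvg0.
move=> K; rewrite cmod_distC.
pose g N : Cplx R := series (fun n => f n w) N -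
    \sum_(0 <= k < K) series (fun n => a n k) N * w ^+ k.
have hl : ccvg g (l - series (fun k => A k * w ^+ k) K).
  have hs := @ccvg_sum _ _ (index_iota 0 K) _ _ (fun k => ccvg_mulr (c := w ^+ k) (hA k)).
  exact: (ccvgB fl hs).
apply: (cmod_cvg_le hl) => N.
have -> : g N = \sum_(0 <= n < N) (f n w - series (fun k => a n k * w ^+ k) K).
  rewrite sumrB; congr (_ - _); rewrite /series /= exchange_big /=.
  by apply: eq_bigr => k _; rewrite mulr_suml.
rewrite (le_trans (cmod_sum _ _ _)) //.
apply: (@le_trans _ _ (\sum_(0 <= n < N) b n * (2 * 2^-1 ^+ K))).
  apply: ler_sum => n _; apply: (series_tail_le K (b0 n) half _ (af n w)) => i.
  exact: cauchy_term_le (est n i) wr.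
by rewrite -mulr_suml ler_wpM2r // mulr_ge0 // exprn_ge0 // invr_ge0.
Qed.

Lemma power_series_eq0 (R : realType) (a : nat -> Cplx R) (e : R) : 0 < e ->
  (forall x : R, 0 < x < e -> series (fun k => a k * x%:C ^+ k) @ \oo --> (0 : Cplx R)) ->
  forall k, a k = 0.
Proof.
move=> e0 ha; pose x0 := e / 2.
have x00 : 0 < x0 by rewrite divr_gt0.
have [|K K0 hK] := cvg_series_terms_bounded (ha x0 _).
  by rewrite x00 /x0; lra.
elim/ltn_ind => m IH; apply/eqP; rewrite -cmod_eq0 eq_le cmod_ge0 andbT.
apply/ler_addgt0Pr => d d0; rewrite add0r.
have xm0 : 0 < x0 ^+ m by rewrite exprn_gt0.
pose t := Num.min 2^-1 (d * x0 ^+ m / (2 * K + 1)).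
have K1 : 0 < 2 * K + 1 by lra.
have t0 : 0 < t by rewrite lt_min invr_gt0 ltr0n /= divr_gt0 // mulr_gt0.
have t2 : t <= 2^-1 by rewrite ge_min lexx.
have td : t * (2 * K + 1) <= d * x0 ^+ m.
  by rewrite -ler_pdivlMr // ge_min lexx orbT.
have tx : 0 < t * x0 < e.
  rewrite mulr_gt0 //= /x0; have : t * (e / 2) <= 2^-1 * (e / 2) by rewrite ler_wpM2r // ltW.
  lra.
have := @series_tail_le _ _ _ K t m.+1 K0 _ _ (ha _ tx).
rewrite (ltW t0) t2 => /(_ isT); have hterm i : cmod (a i * (t * x0)%:C ^+ i) <= K * t ^+ i.
  apply: le_trans (_ : cmod (a i * x0%:C ^+ i) * t ^+ i <= _).
    by rewrite !cmodM !cmodX !cmod_real normrM (gtr0_norm t0) exprMn mulrCA mulrC.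
  by rewrite ler_wpM2r // exprn_ge0 // ltW.
move=> /(_ hterm); rewrite sub0r cmodN /series /= big_nat_recr //= big1_seq => [|i]; last first.
  by rewrite mem_index_iota /= => im; rewrite IH // mul0r.
rewrite add0r cmodM cmodX cmod_real (gtr0_norm (mulr_gt0 t0 x00)) exprMn => h.
have tm0 : 0 < t ^+ m by rewrite exprn_gt0.
have h2 : cmod (a m) * x0 ^+ m <= K * (2 * t).
  rewrite -(ler_pM2l tm0); apply: le_trans (le_trans h _); rewrite ?exprS; lra.
rewrite -(ler_pM2r xm0); apply: (le_trans h2); apply: le_trans td; nra.
Qed.

Lemma analytic_eq0_ray (R : realType) (d : Cplx R -> Cplx R) (b : R) :
  (forall t : R, analytic_at d t%:C) ->
  (forall t : R, b < t -> d t%:C = 0) ->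
  forall t : R, d t%:C = 0.
Proof.
move=> dan db x; apply/eqP/negPn/negP => dx.
pose E := [set t : R | forall u, t <= u -> d u%:C = 0].
have Eb : E (b + 1) by move=> u bu; apply: db; lra.
have Ex t : E t -> x <= t.
  by move=> Et; rewrite leNgt; apply/negP => tx; rewrite Et ?eqxx ?ltW // in dx.
have infE : has_inf E by split; [exists (b + 1)|exists x => t /Ex].
pose t0 := inf E.
have gt0 u : t0 < u -> d u%:C = 0.
  move=> tu; have [|t Et tlt] := @inf_adherent _ E (u - t0) _ infE.
    by rewrite subr_gt0.
  by apply: Et; rewrite ltW //; move: tlt; rewrite /t0 addrC subrK.
have [a /nbhs_ballP[e' e'0 he]] := dan t0.
have [e e0 eE] : exists2 e : R, 0 < e & e' = e%:C.
  have e'E : e' = (complex.Re e')%:C by apply/esym/RRe_real/gtr0_real.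
  exists (complex.Re e') => //.
  by move: e'0; rewrite e'E /=; rewrite -[X in X -> _]/(is_true (0%:C < (complex.Re e')%:C)) ltcR.
have near (u : R) : `|u| < e -> series (fun n => a n * u%:C ^+ n) @ \oo --> d (t0 + u)%:C.
  move=> ue; have := he (t0 + u)%:C; rewrite /= rmorphD /= addrAC subrr add0r; apply.
  by rewrite /ball /= opprD addrA subrr sub0r normrN cmodE cmod_real eE ltcR.
have a0 : forall k, a k = 0.
  apply: (power_series_eq0 e0) => u /andP[u0 ue].
  rewrite -(gt0 (t0 + u)) ?ltrDl //; apply: near; by rewrite gtr0_norm.
have E' : E (t0 - e / 2).
  move=> u ut; have [uu|uu] := ltP t0 u; first exact: gt0.
  have -> : u = t0 + (u - t0) by rewrite addrC subrK.
  have hlim : series (fun n => a n * (u - t0)%:C ^+ n) @ \oo --> d (t0 + (u - t0))%:C.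
    by apply: near; rewrite ler0_norm; lra.
  apply: (ccvg_unique hlim).
  have -> : series (fun n => a n * (u - t0)%:C ^+ n) = (fun=> 0); last exact: ccvg_cst.
  by apply/funext => n; rewrite /series /= big1 // => i _; rewrite a0 mul0r.
have : t0 <= t0 - e / 2 by apply: ge_inf => //; case: infE.
lra.
Qed.

(** * Differences of n^(-s) *)

Definition cpow (R : realType) (s : Cplx R) (n : nat) : Cplx R :=
  cexp (- s * (ln (n.+1%:R : R))%:C).

Definition fdiff (V : zmodType) (u : nat -> V) : nat -> V :=
  fun n => u n - u n.+1.

Definition shift_diff (R : realType) (f : R -> R) : R -> R :=
  fun x => f x - f (x + 1).

Lemma is_derive_scale (R : realType) (k x : R) :
  is_derive x 1 (fun y : R => k * y) k.
Proof.
have h : is_derive x 1 (k \*: (id : R -> R)) (k *: (1 : R)) by apply: is_deriveZ.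
by move: h; rewrite /GRing.scale /= mulr1.
Qed.

Lemma is_derive_fdiff (R : realType) (f df : R -> R) (x : R) :
  is_derive x 1 f (df x) -> is_derive (x + 1) 1 f (df (x + 1)) ->
  is_derive x 1 (shift_diff f) (shift_diff df x).
Proof.
move=> h1 h2.
have h3 : is_derive x 1 (fun y : R => y + 1) (1 : R) by exact: is_derive_shift.
have := is_derive1_comp (h2 : is_derive ((fun y : R => y + 1) x) 1 f _) h3.
rewrite mulr1 => h4; exact: is_deriveB h1 h4.
Qed.

Lemma iter_shift_diff_le (R : realType) (M : nat) (phi : nat -> R -> R) (x B : R) :
  0 < x ->
  (forall (j : nat) (y : R), 0 < y -> is_derive y 1 (phi j) (phi j.+1 y)) ->
  (forall y : R, x <= y -> `|phi M y| <= B) ->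
  `|iter M (@shift_diff R) (phi 0%N) x| <= B.
Proof.
elim: M phi => [|M IH] phi x0 dphi hB; first exact: hB.
rewrite iterSr; apply: (IH (fun j => shift_diff (phi j))) => // [j y y0|y xy].
  by apply: is_derive_fdiff; apply: dphi => //; rewrite addr_gt0.
have y0 : 0 < y by apply: lt_le_trans xy.
have [|||c] := @MVT R (phi M) (phi M.+1) y (y + 1).
- by rewrite ltrDl.
- by move=> z; rewrite in_itv /= => /andP[yz _]; apply: dphi; apply: lt_trans yz.
- apply: derivable_within_continuous => z; rewrite in_itv /= => /andP[yz _].
  by have [] := dphi M z (lt_le_trans y0 yz).
rewrite in_itv /= => /andP[yc _] E; rewrite /shift_diff -normrN opprB E.
by rewrite addrAC subrr add0r mulr1; apply: hB; rewrite ltW // (le_lt_trans xy).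
Qed.

Definition re_cpow (R : realType) (c s : Cplx R) (x : R) : R :=
  complex.Re (c * cexp (- s * (ln x)%:C)).

Lemma is_derive_re_cpow (R : realType) (c s : Cplx R) (x : R) : 0 < x ->
  is_derive x 1 (re_cpow c s) (re_cpow (- s * c) (s + 1) x).
Proof.
case: c s => [a b] [p t] x0.
pose h (y : R) := expR ((- p) * y) * (a * cos (t * y) + b * sin (t * y)).
have dexp (y : R) : is_derive y 1 (fun y : R => expR ((- p) * y)) (expR ((- p) * y) * (- p)).
  exact: is_derive1_comp (is_derive_expR _) (is_derive_scale _ _).
have dcos (y : R) : is_derive y 1 (fun y => cos (t * y)) (- sin (t * y) * t).
  exact: is_derive1_comp (is_derive_cos _) (is_derive_scale _ _).
have dsin (y : R) : is_derive y 1 (fun y => sin (t * y)) (cos (t * y) * t).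
  exact: is_derive1_comp (is_derive_sin _) (is_derive_scale _ _).
have dcos' (y : R) : is_derive y 1 (fun y => a * cos (t * y)) (a * (- sin (t * y) * t)).
  exact: is_derive1_comp (is_derive_scale _ _) (dcos y).
have dsin' (y : R) : is_derive y 1 (fun y => b * sin (t * y)) (b * (cos (t * y) * t)).
  exact: is_derive1_comp (is_derive_scale _ _) (dsin y).
have dh (y : R) := is_deriveM (dexp y) (is_deriveD (dcos' y) (dsin' y)).
have dhln := is_derive1_comp (dh (ln x)) (is_derive1_ln x0).
have rE (a' b' p' t' y : R) : re_cpow (a' +i* b') (p' +i* t') y =
    expR (- p' * ln y) * (a' * cos (t' * ln y) + b' * sin (t' * ln y)).
  have arg : - (p' +i* t') * (ln y)%:C = (- p' * ln y) +i* (- (t' * ln y)) :> Cplx R.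
    by apply/eqP; rewrite eq_complex /=; apply/andP; split; apply/eqP; ring.
  rewrite /re_cpow arg cexpE cosN sinN /=; ring.
have -> : re_cpow (a +i* b) (p +i* t) = h \o @ln R.
  by apply/funext => y; rewrite rE.
have cE : - (p +i* t : Cplx R) * (a +i* b) = (- (p * a) + t * b) +i* (- (p * b) - t * a).
  by apply/eqP; rewrite eq_complex /=; apply/andP; split; apply/eqP; ring.
have sE : (p +i* t : Cplx R) + 1 = (p + 1) +i* t.
  by apply/eqP; rewrite eq_complex /= addr0 !eqxx.
have alg (E c s y : R) : (E * (a * (- s * t) + b * (c * t)) + (a * c + b * s) * (E * - p)) / y =
   E / y * ((- (p * a) + t * b) * c + (- (p * b) - t * a) * s) by ring.
have eE : expR (- (p + 1) * ln x) = expR (- p * ln x) / x.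
  by rewrite opprD mulrDl expRD mulN1r expRN lnK ?posrE.
move: dhln; rewrite cE sE rE eE; congr is_derive.
rewrite !fctE /GRing.scale /=; exact: alg.
Qed.

Lemma cmod_re_cpow (R : realType) (c s : Cplx R) (x : R) :
  `|re_cpow c s x| <= cmod c * expR (- complex.Re s * ln x).
Proof.
rewrite (le_trans (ler_Re_cmod _)) // cmodM cmod_cexp.
by case: s => p t /=; rewrite mulr0 subr0.
Qed.

Lemma iter_fdiff_re (R : realType) (c : Cplx R) (u : nat -> Cplx R) (f : R -> R) :
  (forall n, complex.Re (c * u n) = f n.+1%:R) ->
  forall M n, complex.Re (c * iter M (@fdiff (Cplx R)) u n) =
    iter M (@shift_diff R) f n.+1%:R.
Proof.
move=> uf; elim=> [|M IH] n; first exact: uf.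
by rewrite !iterS /fdiff mulrBr ReD ReN !IH /shift_diff -[in n.+2%:R]addn1 natrD.
Qed.

Definition rising_product (R : realType) (x : R) (M : nat) : R :=
  \prod_(0 <= j < M) (x + j%:R).

Lemma rising_product_ge0 (R : realType) (x : R) (M : nat) : 0 <= x -> 0 <= rising_product x M.
Proof. by move=> x0; apply: prodr_ge0 => j _; rewrite addr_ge0. Qed.

Lemma iter_fdiff_cpow_re_le (R : realType) (M n : nat) (c s : Cplx R) :
  0 <= complex.Re s + M%:R -> cmod c <= 1 ->
  `|complex.Re (c * iter M (@fdiff (Cplx R)) (cpow s) n)| <=
    rising_product (cmod s) M * expR (- (complex.Re s + M%:R) * ln n.+1%:R).
Proof.
move=> sM c1; rewrite (@iter_fdiff_re _ c (cpow s) (re_cpow c s)) //.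
pose a j : Cplx R := \prod_(0 <= i < j) (- (s + i%:R)) * c.
pose phi j := re_cpow (a j) (s + j%:R).
have -> : re_cpow c s = phi 0%N by rewrite /phi /a big_geq // mul1r addr0.
apply: iter_shift_diff_le => [|j y y0|y ny]; first by rewrite ltr0n.
  rewrite /phi; have -> : a j.+1 = - (s + j%:R) * a j.
    by rewrite /a big_nat_recr //= [X in X * _]mulrC mulrA.
  have -> : s + j.+1%:R = s + j%:R + 1 by rewrite -addn1 natrD addrA.
  exact: is_derive_re_cpow.
have y0 : 0 < y by apply: lt_le_trans ny; rewrite ltr0n.
rewrite (le_trans (cmod_re_cpow _ _ _)) //.
have reM : complex.Re (s + M%:R) = complex.Re s + M%:R.
  by rewrite ReD; congr (_ + _); rewrite -(rmorph_nat (@real_complex_def R (Phant R))).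
rewrite reM; apply: ler_pM; rewrite ?cmod_ge0 ?expR_ge0 //.
  rewrite /a /rising_product cmodM -[leRHS]mulr1; apply: ler_pM; rewrite ?cmod_ge0 //.
  elim: (M) => [|j IH]; first by rewrite !big_geq // cmod1.
  rewrite !big_nat_recr //= cmodM; apply: ler_pM; rewrite ?cmod_ge0 //.
  by rewrite cmodN (le_trans (cmodD _ _)) // cmod_nat.
rewrite ler_expR !mulNr lerN2 ler_wpM2l // ler_ln ?posrE ?ltr0n //.
Qed.

Lemma cmod_iter_fdiff_cpow (R : realType) (M n : nat) (s : Cplx R) :
  0 <= complex.Re s + M%:R ->
  cmod (iter M (@fdiff (Cplx R)) (cpow s) n) <=
    2 * (rising_product (cmod s) M * expR (- (complex.Re s + M%:R) * ln n.+1%:R)).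
Proof.
move=> sM; rewrite (le_trans (ler_cmod_ReIm _)) // mulr_natl mulr2n; apply: lerD.
  have := @iter_fdiff_cpow_re_le R M n 1 s sM; rewrite mul1r; apply.
  by rewrite cmod1.
have := @iter_fdiff_cpow_re_le R M n (0 -i* 1) s sM.
have -> : complex.Re ((0 -i* 1 : Cplx R) * iter M (@fdiff (Cplx R)) (cpow s) n) =
    complex.Im (iter M (@fdiff (Cplx R)) (cpow s) n).
  by case: (iter _ _ _ _) => x y /=; ring.
by apply; rewrite cmodEsqrt /= expr0n add0r sqrrN expr1n sqrtr1.
Qed.

Lemma pseries_le (R : realType) (a : R) (N : nat) : 1 < a ->
  \sum_(0 <= n < N) expR (- a * ln n.+1%:R) <= 1 + (a - 1)^-1.
Proof.
move=> a1; pose eta := a - 1; have eta0 : 0 < eta by rewrite subr_gt0.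
suff H : \sum_(0 <= n < N.+1) expR (- a * ln n.+1%:R) <=
    1 + eta^-1 * (1 - expR (- eta * ln N.+1%:R)).
  apply: (@le_trans _ _ (\sum_(0 <= n < N.+1) expR (- a * ln n.+1%:R))).
    by rewrite big_nat_recr //= lerDl expR_ge0.
  have e1 : 1 - expR (- eta * ln N.+1%:R) <= 1 by rewrite gerBl expR_ge0.
  by apply: (le_trans H); rewrite lerD2l ler_piMr // invr_ge0 ltW.
elim: N => [|N IH].
  by rewrite big_nat1 ln1 !mulr0 expR0 subrr mulr0 addr0.
rewrite big_nat_recr //= (le_trans (lerD IH (lexx _))) //.
set m : R := N.+1%:R; set k : R := N.+2%:R.
have m0 : 0 < m by rewrite ltr0n.
have kE : k = m + 1 by rewrite /k -addn1 natrD.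
have k0 : 0 < k by rewrite ltr0n.
clearbody m k.
have lnk : ln m + k^-1 <= ln k.
  have : m / k <= expR (- k^-1).
    have mE : m = k - 1 by rewrite kE addrK.
    have -> : m / k = 1 + - k^-1 by rewrite mE mulrBl mulfV ?gt_eqF // mul1r.
    exact: expR_ge1Dx.
  move=> h; have : ln (m / k) <= ln (expR (- k^-1)).
    by rewrite ler_ln ?posrE ?divr_gt0 ?expR_gt0.
  rewrite expRK ln_div ?posrE //; lra.
have step : expR (- eta * ln k) * (1 + eta / k) <= expR (- eta * ln m).
  have -> : - eta * ln m = - eta * ln k + eta * (ln k - ln m) by ring.
  rewrite expRD ler_wpM2l ?expR_ge0 //.
  apply: le_trans (expR_ge1Dx _); rewrite lerD2l ler_wpM2l ?(ltW eta0) //; lra.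
have aE : expR (- a * ln k) = expR (- eta * ln k) / k.
  have -> : - a * ln k = - eta * ln k + - ln k by rewrite /eta; ring.
  by rewrite expRD expRN lnK.
rewrite aE -subr_ge0.
have -> : 1 + eta^-1 * (1 - expR (- eta * ln k)) -
    (1 + eta^-1 * (1 - expR (- eta * ln m)) + expR (- eta * ln k) / k) =
    eta^-1 * (expR (- eta * ln m) - expR (- eta * ln k) * (1 + eta / k)).
  by field; rewrite !gt_eqF.
by rewrite mulr_ge0 ?invr_ge0 ?(ltW eta0) // subr_ge0.
Qed.

Definition cpow_coef (R : realType) (s : Cplx R) (k n : nat) : Cplx R :=
  cpow s n * ((- (ln (n.+1%:R : R))%:C) ^+ k / k`!%:R).

Lemma iter_fdiff_cpow_series (R : realType) (s w : Cplx R) (M n : nat) :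
  ccvg (series (fun k => iter M (@fdiff (Cplx R)) (cpow_coef s k) n * w ^+ k))
    (iter M (@fdiff (Cplx R)) (cpow (s + w)) n).
Proof.
elim: M n => [|M IH] n /=.
  have := ccvg_mull (c := cpow s n) (@exp_sum_cexp R (w * - (ln (n.+1%:R : R))%:C)).
  have -> : cpow s n * cexp (w * - (ln n.+1%:R)%:C) = cpow (s + w) n.
    by rewrite /cpow -cexpD; congr cexp; ring.
  congr ccvg; apply/funext => N; rewrite /exp_sum /series /= mulr_sumr.
  by apply: eq_bigr => k _; rewrite /cpow_coef exprMn; ring.
have := ccvgB (IH n) (IH n.+1); congr ccvg; apply/funext => N.
rewrite /series /= -sumrB; apply: eq_bigr => k _.
by rewrite /fdiff mulrBl.
Qed.

(** * Analytic continuation by repeated summation by parts *)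

Definition mean_zero (R : realType) (q : nat) (f : nat -> Cplx R) : Prop :=
  (forall n, f (n + q)%N = f n) /\ \sum_(0 <= j < q) f j = 0.

(* The constant for which [antidiff q f] again has mean zero. *)
Definition antidiff_const (R : realType) (q : nat) (f : nat -> Cplx R) : Cplx R :=
  - (q%:R^-1 * \sum_(0 <= j < q) \sum_(0 <= i < j.+1) f i).

Definition antidiff (R : realType) (q : nat) (f : nat -> Cplx R) (n : nat) : Cplx R :=
  antidiff_const q f + \sum_(0 <= i < n.+1) f i.

Lemma mean_zero_antidiff (R : realType) (q : nat) (f : nat -> Cplx R) : (0 < q)%N ->
  mean_zero q f -> mean_zero q (antidiff q f).
Proof.
move=> q0 [fq f0]; split => [n|].
  rewrite /antidiff; congr (_ + _).
  rewrite -addSn (big_cat_nat (leq0n q) (leq_addl n.+1 q)) /= f0 add0r.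
  rewrite -{1}[q]add0n big_addn addnK; apply: eq_bigr => i _; exact: fq.
rewrite /antidiff big_split /= sumr_const_nat subn0 /antidiff_const mulNrn.
by rewrite -[_ *+ q in LHS]mulr_natl mulrA mulfV ?pnatr_eq0 -?lt0n // mul1r addNr.
Qed.

Lemma mean_zero_iter (R : realType) (q M : nat) (f : nat -> Cplx R) : (0 < q)%N ->
  mean_zero q f -> mean_zero q (iter M (antidiff q) f).
Proof. by move=> q0 fq; elim: M => //= M; exact: mean_zero_antidiff. Qed.

Lemma mean_zero_bounded (R : realType) (q : nat) (f : nat -> Cplx R) : (0 < q)%N ->
  mean_zero q f -> exists2 K : R, 0 <= K & forall n, cmod (f n) <= K.
Proof.
move=> q0 [fq _]; exists (\sum_(0 <= j < q) cmod (f j)) => [|n].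
  by apply: sumr_ge0 => j _; exact: cmod_ge0.
have fmod j m : f (j + m * q)%N = f j.
  by elim: m => [|m IH]; [rewrite addn0|rewrite mulSn addnCA addnA -[(_ + j)%N]addnC addnAC fq].
rewrite (divn_eq n q) addnC fmod (bigD1_seq (n %% q)%N) ?iota_uniq ?mem_index_iota ?ltn_mod //=.
by rewrite lerDl; apply: sumr_ge0 => j _; exact: cmod_ge0.
Qed.

Lemma abel_summation (R : realType) (q N : nat) (f g : nat -> Cplx R) :
  \sum_(0 <= n < N) f n * g n =
    (antidiff_const q f + \sum_(0 <= i < N) f i) * g N - antidiff_const q f * g 0%N
    + \sum_(0 <= n < N) antidiff q f n * fdiff g n.
Proof.
elim: N => [|N IH]; first by rewrite !big_geq // !addr0 subrr.
rewrite !(big_nat_recr N) //= IH /antidiff /fdiff (big_nat_recr N) //=.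
ring.
Qed.

(* [abel_sum q f M s] is the Dirichlet series of f after M summations by parts,
   and [abel_boundary q f M s] collects the boundary terms. *)
Definition abel_sum (R : realType) (q : nat) (f : nat -> Cplx R) (M : nat) (s : Cplx R) (N : nat)
  : Cplx R :=
  \sum_(0 <= n < N) iter M (antidiff q) f n * iter M (@fdiff (Cplx R)) (cpow s) n.

Definition abel_boundary (R : realType) (q : nat) (f : nat -> Cplx R) (M : nat) (s : Cplx R)
  : Cplx R :=
  - \sum_(0 <= j < M) antidiff_const q (iter j (antidiff q) f) *
      iter j (@fdiff (Cplx R)) (cpow s) 0%N.

Lemma abel_sum_cvg (R : realType) (q M : nat) (f : nat -> Cplx R) (s : Cplx R) :
  (0 < q)%N -> mean_zero q f -> 1 < complex.Re s + M%:R ->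
  exists l, ccvg (abel_sum q f M s) l.
Proof.
move=> q0 fq sM.
have [K K0 hK] := mean_zero_bounded q0 (mean_zero_iter M q0 fq).
pose a := complex.Re s + M%:R.
have [|l hl _] := @abs_series_cvg R (fun n => iter M (antidiff q) f n *
    iter M (@fdiff (Cplx R)) (cpow s) n)
  (K * (2 * rising_product (cmod s) M) * (1 + (a - 1)^-1)); last by exists l.
move=> N; apply: (@le_trans _ _ (\sum_(0 <= n < N) K * (2 * rising_product (cmod s) M) *
   expR (- a * ln n.+1%:R))).
  apply: ler_sum => n _; rewrite cmodM -mulrA; apply: ler_pM; rewrite ?cmod_ge0 //.
  by rewrite -mulrA; apply: cmod_iter_fdiff_cpow; rewrite ltW // (lt_trans _ sM).
rewrite -mulr_sumr ler_wpM2l ?pseries_le //.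
by rewrite !mulr_ge0 // rising_product_ge0 // cmod_ge0.
Qed.

Lemma expR_ln_cvg0 (R : realType) (a K : R) : 0 < a -> 0 <= K ->
  (fun n : nat => K * expR (- a * ln (n.+1%:R : R))) @ \oo --> (0 : R).
Proof.
move=> a0 K0; apply/cvgrPdist_lt => e e0.
pose m := Num.trunc (expR (a^-1 * ln ((K + 1) / e))).
exists m => // n /= mn; rewrite sub0r normrN ger0_norm ?mulr_ge0 ?expR_ge0 //.
have h : expR (a^-1 * ln ((K + 1) / e)) < n.+1%:R.
  apply: (@lt_le_trans _ _ m.+1%:R); last by rewrite ler_nat ltnS.
  by rewrite /m truncnS_gt.
have Ke : 0 < (K + 1) / e by rewrite divr_gt0 // ltr_wpDl.
have h2 : ln ((K + 1) / e) < a * ln n.+1%:R.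
  rewrite -ltr_pdivrMl //.
  by rewrite -ltr_expR [X in _ < X]lnK ?posrE ?ltr0n.
have h3 : (K + 1) / e < expR (a * ln n.+1%:R).
  by rewrite -[X in X < _]lnK ?posrE // ltr_expR.
rewrite mulNr expRN ltr_pdivrMr ?expR_gt0 //.
rewrite -ltr_pdivrMl //; apply: lt_trans h3; rewrite mulrC ltr_pM2r ?invr_gt0 //.
by rewrite ltrDl.
Qed.

Lemma abel_sum_step (R : realType) (q M : nat) (f : nat -> Cplx R) (s l : Cplx R) :
  (0 < q)%N -> mean_zero q f -> 0 < complex.Re s + M%:R ->
  ccvg (abel_sum q f M.+1 s) l ->
  ccvg (abel_sum q f M s) (l - antidiff_const q (iter M (antidiff q) f) *
      iter M (@fdiff (Cplx R)) (cpow s) 0%N).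
Proof.
move=> q0 fq sM hl.
set F := iter M (antidiff q) f; set D := iter M (@fdiff (Cplx R)) (cpow s).
have [K K0 hK] := mean_zero_bounded q0 (mean_zero_iter M.+1 q0 fq).
pose K' := K + cmod (antidiff_const q F).
have hb N : cmod (antidiff_const q F + \sum_(0 <= i < N) F i) <= K'.
  case: N => [|N]; first by rewrite big_geq // addr0 lerDr.
  by apply: (le_trans (hK N)); rewrite lerDl cmod_ge0.
have K'0 : 0 <= K' by rewrite addr_ge0 // cmod_ge0.
have b0 : ccvg (fun N => (antidiff_const q F + \sum_(0 <= i < N) F i) * D N) 0.
  apply: (@cvgC_squeeze _ _ _ (fun N => K' * (2 * rising_product (cmod s) M) *
     expR (- (complex.Re s + M%:R) * ln N.+1%:R))).
    move=> N; rewrite subr0 cmodM -mulrA; apply: ler_pM; rewrite ?cmod_ge0 //.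
    by rewrite -mulrA; apply: cmod_iter_fdiff_cpow; exact: ltW.
  apply: expR_ln_cvg0 => //.
  by rewrite !mulr_ge0 // rising_product_ge0 // cmod_ge0.
have := ccvgD (ccvgB b0 (@ccvg_cst R (antidiff_const q F * D 0%N))) hl.
rewrite sub0r addrC; congr ccvg; apply/funext => N.
by rewrite [RHS]/abel_sum (abel_summation q).
Qed.

Lemma continuation_exists (R : realType) (q : nat) (f : nat -> Cplx R) :
  (0 < q)%N -> mean_zero q f ->
  exists L : Cplx R -> Cplx R, forall s M, 1 < complex.Re s + M%:R ->
    ccvg (abel_sum q f M s) (L s - abel_boundary q f M s).
Proof.
move=> q0 fq.
suff /choice[L hL] : forall s, exists l, forall M, 1 < complex.Re s + M%:R ->
    ccvg (abel_sum q f M s) (l - abel_boundary q f M s) by exists L.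
move=> s.
have up M l : 1 < complex.Re s + M%:R ->
    ccvg (abel_sum q f M s) (l - abel_boundary q f M s) ->
    ccvg (abel_sum q f M.+1 s) (l - abel_boundary q f M.+1 s).
  move=> sM hl; have [|l' hl'] := @abel_sum_cvg R q M.+1 f s q0 fq.
    by apply: lt_trans sM _; rewrite ltrD2l ltr_nat.
  have := abel_sum_step q0 fq (lt_trans ltr01 sM) hl'.
  move=> /(ccvg_unique hl) E; suff -> : l - abel_boundary q f M.+1 s = l' by [].
  move: E; rewrite /abel_boundary big_nat_recr //= !opprK => /eqP.
  by rewrite eq_sym subr_eq => /eqP ->; rewrite addrA.
have ex M : 1 < complex.Re s + M%:R ->
    exists l, ccvg (abel_sum q f M s) (l - abel_boundary q f M s).
  move=> sM; have [l hl] := abel_sum_cvg q0 fq sM.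
  by exists (l + abel_boundary q f M s); rewrite addrK.
have ups M k l : 1 < complex.Re s + M%:R ->
    ccvg (abel_sum q f M s) (l - abel_boundary q f M s) ->
    ccvg (abel_sum q f (k + M) s) (l - abel_boundary q f (k + M) s).
  move=> sM hl; elim: k => [|k IH]; first exact: hl.
  apply: up IH; apply: lt_le_trans sM _.
  by rewrite lerD2l ler_nat leq_addl.
pose M0 := (Num.trunc (1 - complex.Re s)).+1.
have sM0 : 1 < complex.Re s + M0%:R by rewrite -ltrBlDl truncnS_gt.
have [l hl] := ex _ sM0; exists l => M sM.
have [l' hl'] := ex _ sM.
have h1 := ups _ M _ sM0 hl; have h2 := ups _ M0 _ sM hl'.
rewrite addnC in h2; have := ccvg_unique h1 h2 => /addIr ->.
exact: hl'.
Qed.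

Lemma rising_product_le (R : realType) (x y : R) (M : nat) : 0 <= x -> x <= y ->
  rising_product x M <= rising_product y M.
Proof.
by move=> x0 xy; apply: ler_prod => j _; rewrite addr_ge0 //= lerD2r.
Qed.

Lemma continuation_analytic (R : realType) (q : nat) (f : nat -> Cplx R)
  (L : Cplx R -> Cplx R) : (0 < q)%N -> mean_zero q f ->
  (forall s M, 1 < complex.Re s + M%:R ->
    ccvg (abel_sum q f M s) (L s - abel_boundary q f M s)) ->
  forall s, analytic_at L s.
Proof.
move=> q0 fq hL s0.
pose M := (Num.trunc (2 - complex.Re s0)).+1.
have sM : 1 < complex.Re s0 - 1 + M%:R.
  have : 2 - complex.Re s0 < M%:R by rewrite truncnS_gt.
  lra.
have [K K0 hK] := mean_zero_bounded q0 (mean_zero_iter M q0 fq).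
pose c := iter M (antidiff q) f.
pose a n k : Cplx R := c n * iter M (@fdiff (Cplx R)) (cpow_coef s0 k) n.
pose g n w : Cplx R := c n * iter M (@fdiff (Cplx R)) (cpow (s0 + w)) n.
pose fb := rising_product (cmod s0 + 1) M.
have fb0 : 0 <= fb by rewrite rising_product_ge0 // addr_ge0 // cmod_ge0.
pose e := complex.Re s0 - 1 + M%:R.
pose b n := K * (2 * fb) * expR (- e * ln (n.+1%:R : R)).
have ag n w : ccvg (series (fun k => a n k * w ^+ k)) (g n w).
  have := ccvg_mull (c := c n) (@iter_fdiff_cpow_series R s0 w M n); congr ccvg.
  by apply/funext => N; rewrite /series /= mulr_sumr; apply: eq_bigr => k _; rewrite mulrA.
have Rew w : cmod w <= 1 -> complex.Re s0 - 1 <= complex.Re (s0 + w).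
  move=> w1; rewrite ReD lerD2l; have := le_trans (ler_Re_cmod w) w1.
  by rewrite ler_norml => /andP[].
have gb n w : cmod w <= 1 -> cmod (g n w) <= b n.
  move=> w1; have Rw := Rew w w1.
  rewrite /g /b cmodM -mulrA; apply: ler_pM; rewrite ?cmod_ge0 //.
  apply: (le_trans (cmod_iter_fdiff_cpow _ _)).
    by apply: (@le_trans _ _ e); [exact: ltW (lt_trans ltr01 sM)|rewrite lerD2r].
  rewrite -mulrA ler_wpM2l //; apply: ler_pM; rewrite ?expR_ge0 ?rising_product_ge0 ?cmod_ge0 //.
    by apply: rising_product_le; rewrite ?cmod_ge0 // (le_trans (cmodD _ _)) // lerD2l.
  by rewrite ler_expR !mulNr lerN2 ler_wpM2r ?ln_ge0 ?ler1n // lerD2r.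
have bS N : \sum_(0 <= n < N) b n <= K * (2 * fb) * (1 + (e - 1)^-1).
  by rewrite -mulr_sumr ler_wpM2l ?pseries_le // !mulr_ge0.
have [A hA] := weierstrass_power_series ltr01 ag gb bS.
pose H k : Cplx R := - \sum_(0 <= j < M) antidiff_const q (iter j (antidiff q) f) *
      iter j (@fdiff (Cplx R)) (cpow_coef s0 k) 0%N.
have hH w : ccvg (series (fun k => H k * w ^+ k)) (abel_boundary q f M (s0 + w)).
  have hs := ccvgN (@ccvg_sum R nat (index_iota 0 M) _ _ (fun j =>
    ccvg_mull (c := antidiff_const q (iter j (antidiff q) f))
     (@iter_fdiff_cpow_series R s0 w j 0%N))).
  move: hs; congr ccvg; apply/funext => N.
  rewrite /series /= /H; under [RHS]eq_bigr => k _ do rewrite mulNr mulr_suml.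
  rewrite sumrN exchange_big /=; congr (- _); apply: eq_bigr => j _.
  by rewrite mulr_sumr; apply: eq_bigr => k _; rewrite mulrA.
exists (fun k => A k + H k).
apply/nbhs_ballP; exists ((2^-1 : R)%:C) => /=.
  by rewrite -[X in is_true X]/(0%:C < (2^-1 : R)%:C) ltcR invr_gt0.
move=> s; rewrite /ball /= cmodE ltcR => sw.
pose w := s - s0.
have w2 : cmod w < 2^-1 by rewrite /w cmod_distC.
have sE : s = s0 + w by rewrite /w addrC subrK.
have hl : ccvg (series (fun n => g n w)) (L s - abel_boundary q f M s).
  have := hL s M _; rewrite sE; apply.
  apply: lt_le_trans sM _; rewrite lerD2r; apply: Rew.
  by rewrite ltW // (lt_trans w2) // invf_lt1 // ltr1n.
have wr : cmod w <= 1 / 2 by rewrite mul1r ltW.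
have := ccvgD (hA w _ wr hl) (hH w).
rewrite -sE subrK; congr ccvg; apply/funext => N.
by rewrite /series /= -big_split /=; apply: eq_bigr => k _; rewrite -mulrDl.
Qed.

Lemma is_dirichlet_L_exists (R : realType) (q : nat) (chi : int -> Cplx R) :
  (0 < q)%N -> mean_zero q (fun n => chi n.+1%:Z) ->
  exists2 L, is_dirichlet_L q chi L &
    forall s, 0 < complex.Re s -> ccvg (series (fun n => chi n.+1%:Z * cpow s n)) (L s).
Proof.
move=> q0 fq; have [L hL] := continuation_exists q0 fq; exists L; first split.
- move=> s s1; have := hL s 0%N; rewrite addr0 /abel_boundary big_geq // oppr0 subr0.
  by move=> /(_ s1); exact.
- by move=> s _; exact: continuation_analytic hL s.
move=> s s0; have s1 : 1 < complex.Re s + 1%:R by rewrite ltrDr.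
have s00 : 0 < complex.Re s + 0%:R by rewrite addr0.
have := abel_sum_step q0 fq s00 (hL s 1%N s1).
by rewrite /abel_boundary big_nat1 opprK addrK.
Qed.

Lemma is_dirichlet_L_unique (R : realType) (q : nat) (chi : int -> Cplx R)
  (L1 L2 : Cplx R -> Cplx R) : chi <> principal_character R q ->
  is_dirichlet_L q chi L1 -> is_dirichlet_L q chi L2 ->
  forall t : R, L1 t%:C = L2 t%:C.
Proof.
move=> chi1 [h1 a1] [h2 a2] t; apply/eqP; rewrite -subr_eq0; apply/eqP.
apply: (@analytic_eq0_ray R (fun s => L1 s - L2 s) 1) => [u|u u1].
  have [b1 nb1] := a1 u%:C (or_introl chi1); have [b2 nb2] := a2 u%:C (or_introl chi1).
  exists (fun n => b1 n - b2 n); apply: filterS2 nb1 nb2 => z c1 c2.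
  have := ccvgB c1 c2; congr ccvg; apply/funext => N.
  by rewrite /series /= -sumrB; apply: eq_bigr => k _; rewrite mulrBl.
apply/eqP; rewrite subr_eq0; apply/eqP.
exact: ccvg_unique (h1 u%:C u1) (h2 u%:C u1).
Qed.

Lemma dirichlet_L_cvg (R : realType) (q : nat) (chi : int -> Cplx R) (t : R) :
  (0 < q)%N -> chi <> principal_character R q ->
  mean_zero q (fun n => chi n.+1%:Z) -> 0 < t ->
  ccvg (series (fun n => chi n.+1%:Z * cpow t%:C n)) (dirichlet_L q chi t%:C).
Proof.
move=> q0 chi1 fq t0; have [L hL cL] := is_dirichlet_L_exists q0 fq.
have dL : is_dirichlet_L q chi (dirichlet_L q chi).
  exact: (@xgetPex _ (fun=> 0) [set M | is_dirichlet_L q chi M] (ex_intro _ L hL)).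
by rewrite (is_dirichlet_L_unique chi1 dL hL t); apply: cL.
Qed.

(** * Characters modulo a prime *)

Lemma Fp_fermat (q : nat) (x : 'F_q) : prime q -> x != 0 -> x ^+ q.-1 = 1.
Proof.
move=> pq x0; apply: (mulfI x0); rewrite -exprS prednK ?prime_gt0 // mulr1.
by have := finfield.expf_card x; rewrite (card_Fp pq).
Qed.

Lemma Fp_prim_root_exists (q : nat) : prime q -> exists g : 'F_q, q.-1.-primitive_root g.
Proof.
move=> pq; have q1 : (0 < q.-1)%N by have := prime_gt1 pq; lia.
pose rs := [seq x <- enum 'F_q | x != 0].
have [|||g _ gP] := @hasP _ _ rs (has_prim_root q1 _ _ _); last by exists g.
- apply/allP => x; rewrite mem_filter unity_rootE => /andP[x0 _].
  by rewrite Fp_fermat.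
- by rewrite filter_uniq // enum_uniq.
have := count_predC (pred1 (0 : 'F_q)) (enum 'F_q).
rewrite -cardE card_Fp // size_filter count_uniq_mem ?enum_uniq // mem_enum /=.
set c := count (predC _) _ => cq; have h : (q.-1 <= c)%N by lia.
exact: h.
Qed.

Lemma Fp_log_exists (q : nat) (g : 'F_q) : prime q -> q.-1.-primitive_root g ->
  exists ind : 'F_q -> nat, forall x, x != 0 -> g ^+ ind x = x.
Proof.
move=> pq gP.
have h (x : 'F_q) : exists i : nat, x != 0 -> g ^+ i = x.
  have [x0|x0] := eqVneq x 0; first by exists 0%N.
  by have [i ->] := prim_rootP gP (Fp_fermat pq x0); exists i.
by have [ind indP] := choice h; exists ind.
Qed.

Lemma Fp_nat_eq (q : nat) (m n : nat) : prime q ->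
  (m%:R == n%:R :> 'F_q) = (m == n %[mod q]).
Proof.
by move=> pq; apply/eqP/eqP => [/(congr1 val)|h]; [|apply/val_inj];
   rewrite /= !val_Fp_nat.
Qed.

(* The character sending a primitive root g to a, where [ind] is a discrete
   logarithm to the base g. *)
Definition log_char (R : realType) (q : nat) (ind : 'F_q -> nat) (a : Cplx R) (n : int)
  : Cplx R :=
  if n%:~R == 0 :> 'F_q then 0 else a ^+ ind n%:~R.

Section LogChar.
Context (R : realType) (q : nat) (pq : prime q) (g : 'F_q).
Context (gP : q.-1.-primitive_root g) (ind : 'F_q -> nat).
Context (indP : forall x, x != 0 -> g ^+ ind x = x).

Let coprime_Fp (n : int) : coprimez n q%:Z = (n%:~R != 0 :> 'F_q).
Proof.
by rewrite -(dvdz_pcharf (pchar_Fp pq)) coprimez_sym /coprimez /gcdz /dvdz /= -prime_coprime.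
Qed.

Let g0 : g != 0.
Proof. by rewrite (prim_root_eq0 gP); have := prime_gt1 pq; case: q => // [] []. Qed.

Let gn0 i : g ^+ i != 0. Proof. exact: expf_neq0. Qed.

Lemma log_expr_eq (a : Cplx R) (i j : nat) : a ^+ q.-1 = 1 -> g ^+ i = g ^+ j ->
  a ^+ i = a ^+ j.
Proof.
move=> aQ /eqP; rewrite (eq_prim_root_expr gP) => /eqP ij.
by rewrite -(expr_mod i aQ) -(expr_mod j aQ) ij.
Qed.

Lemma log_char_expr (a : Cplx R) (n : int) (i : nat) : a ^+ q.-1 = 1 ->
  n%:~R = g ^+ i -> log_char ind a n = a ^+ i.
Proof.
move=> aQ nE; rewrite /log_char nE (negbTE (gn0 i)).
by apply: log_expr_eq => //; apply: indP.
Qed.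

Lemma log_char_character (a : Cplx R) : a ^+ q.-1 = 1 ->
  dirichlet_character q (log_char ind a).
Proof.
move=> aQ; split=> [m n|n|n].
- have [m0|m0] := eqVneq (m%:~R : 'F_q) 0.
    by rewrite /log_char rmorphM /= m0 mul0r eqxx mul0r.
  have [n0|n0] := eqVneq (n%:~R : 'F_q) 0.
    by rewrite /log_char rmorphM /= n0 mulr0 eqxx mulr0.
  rewrite (log_char_expr aQ (esym (indP m0))) (log_char_expr aQ (esym (indP n0))).
  by rewrite -exprD; apply: log_char_expr => //; rewrite exprD !indP // rmorphM.
- rewrite /log_char; suff -> : (n + q%:Z)%:~R = n%:~R :> 'F_q by [].
  by rewrite rmorphD /= [(q%:Z)%:~R](pcharf0 (pchar_Fp pq)) addr0.
rewrite coprime_Fp /log_char; have [n0|n0] := eqVneq (n%:~R : 'F_q) 0.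
  by rewrite eqxx.
have a0 : a != 0.
  apply/eqP => a0; have := prim_order_gt0 gP; move: aQ; rewrite a0 expr0n.
  by case: (q.-1) => //= k /eqP; rewrite eq_sym oner_eq0.
by split=> // _; exact: expf_neq0.
Qed.

Lemma int_lift (x : 'F_q) : (((x : nat)%:Z)%:~R : 'F_q) = x.
Proof. by rewrite -[RHS]natr_Zp. Qed.

Lemma log_charX (a : Cplx R) (k : nat) : (0 < k)%N ->
  (fun n => log_char ind a n ^+ k) = log_char ind (a ^+ k).
Proof.
move=> k0; apply/funext => n; rewrite /log_char.
by case: ifP => _; [rewrite expr0n gtn_eqF|rewrite -!exprM mulnC].
Qed.

Lemma log_char_inj (a b : Cplx R) : a ^+ q.-1 = 1 -> b ^+ q.-1 = 1 ->
  log_char ind a = log_char ind b -> a = b.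
Proof.
move=> aQ bQ /(congr1 (fun f => f (g : nat)%:Z)).
by rewrite !(log_char_expr (i := 1%N)) // int_lift.
Qed.

Lemma log_char_principal : log_char ind (1 : Cplx R) = principal_character R q.
Proof.
apply/funext => n; rewrite /log_char /principal_character coprime_Fp.
by case: eqP => //= _; rewrite expr1n.
Qed.

Lemma log_char_order (a : Cplx R) : a ^+ q.-1 = 1 ->
  character_has_order q (log_char ind a) q.-1 <-> q.-1.-primitive_root a.
Proof.
move=> aQ; have Q0 := prim_order_gt0 gP.
have step k : (0 < k)%N ->
    (fun n => log_char ind a n ^+ k) = principal_character R q <-> a ^+ k = 1.
  move=> k0; rewrite log_charX // -log_char_principal; split => [h|->//].
  by apply: log_char_inj h; rewrite ?expr1n // -exprM mulnC exprM aQ expr1n.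
split => [[_ _ h]|aP].
  have [m mP mQ] := prim_order_exists Q0 aQ.
  have m0 := prim_order_gt0 mP.
  have := dvdn_leq Q0 mQ; rewrite leq_eqVlt => /orP[/eqP <- //|mlt].
  by case: (h m); rewrite ?m0 ?mlt //; apply/(step m m0); exact: prim_expr_order.
split=> //; first by apply/(step _ Q0).
move=> j /andP[j0 jQ] /(step j j0) /eqP.
by rewrite -(prim_order_dvd aP) => /(dvdn_leq j0); rewrite leqNgt jQ.
Qed.

Lemma character_log_char (chi : int -> Cplx R) : dirichlet_character q chi ->
  exists2 a : Cplx R, a ^+ q.-1 = 1 & chi = log_char ind a.
Proof.
move=> [chiM chiq chi0].
have chi1 : chi 1 = 1.
  have : chi 1 != 0 by apply/chi0; rewrite coprime_Fp rmorph1 oner_eq0.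
  move=> c0; apply: (mulfI c0); by rewrite -chiM !mulr1.
have chiqn (n : int) (k : nat) : chi (n + (q * k)%:Z) = chi n.
  elim: k => [|k IH]; first by rewrite muln0 addr0.
  by rewrite mulnS PoszD addrCA addrC chiq.
have chiE (m n : int) : m%:~R = n%:~R :> 'F_q -> chi m = chi n.
  move=> mn; have : (q %| m - n)%Z.
    by rewrite (dvdz_pcharf (pchar_Fp pq)) rmorphB /= mn subrr.
  move=> /dvdzP[k mE]; have {mE}mE : m = n + k * q%:Z by rewrite -mE addrC subrK.
  case: k mE => k ->.
    by rewrite mulrC -PoszM chiqn.
  by rewrite -(chiqn _ k.+1) NegzE mulNr -PoszM [(k.+1 * q)%N]mulnC subrK.
have chiX (m : int) i : chi (m ^+ i) = chi m ^+ i.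
  by elim: i => [|i IH]; rewrite ?expr0 // !exprS chiM IH.
pose a := chi (g : nat)%:Z; exists a.
  rewrite -chiX -chi1; apply: chiE.
  by rewrite rmorphXn /= int_lift (prim_expr_order gP) rmorph1.
apply/funext => n; rewrite /log_char; case: eqVneq => [n0|n0].
  by apply/eqP/negPn/negP => /chi0; rewrite coprime_Fp n0 eqxx.
by rewrite /a -chiX; apply: chiE; rewrite rmorphXn /= int_lift indP.
Qed.

Lemma log_char_mean_zero (a : Cplx R) : a ^+ q.-1 = 1 -> a != 1 ->
  mean_zero q (fun n => log_char ind a n.+1%:Z).
Proof.
move=> aQ a1; split=> [n|].
  have [_ + _] := log_char_character aQ; move=> /(_ n.+1%:Z) <-.
  by rewrite -PoszD addSn.
have per n : log_char ind a (n + q)%N%:Z = log_char ind a n%:Z.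
  by rewrite PoszD; have [_ + _] := log_char_character aQ; apply.
have -> : \sum_(0 <= j < q) log_char ind a j.+1%:Z =
          \sum_(0 <= j < q) log_char ind a j%:Z.
  rewrite -(@sum_periodic_shift _ q 1%N (fun j => log_char ind a j%:Z)) //.
  by apply: eq_bigr => j _; rewrite addn1.
pose h (x : 'F_q) : Cplx R := if x == 0 then 0 else a ^+ ind x.
have -> : \sum_(0 <= j < q) log_char ind a j%:Z = \sum_(x : 'F_q) h x.
  rewrite -(big_map (fun j : nat => j%:R : 'F_q) xpredT h).
  rewrite -[RHS]big_enum; apply: perm_big; apply: uniq_perm.
  - rewrite map_inj_in_uniq ?iota_uniq // => i j; rewrite !mem_index_iota /= => iq jq.
    by move=> /eqP; rewrite Fp_nat_eq // !modn_small // => /eqP.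
  - exact: enum_uniq.
  move=> x; rewrite mem_enum; apply/mapP; exists (x : nat).
    rewrite mem_index_iota /=; have := ltn_ord x.
    by rewrite [X in (_ < X)%N -> _]Fp_cast.
  by rewrite natr_Zp.
have hg x : h (g * x) = a * h x.
  rewrite /h mulf_eq0 (negbTE g0) /=; case: eqVneq => [|x0]; first by rewrite mulr0.
  rewrite -exprS; apply: log_expr_eq => //.
  by rewrite exprS !indP // mulf_neq0.
have E : \sum_(x : 'F_q) h x = a * \sum_(x : 'F_q) h x.
  rewrite mulr_sumr [LHS](reindex_inj (mulfI g0)) /=.
  by apply: eq_bigr => x _; exact: hg.
apply/eqP; have /eqP : (1 - a) * \sum_(x : 'F_q) h x = 0.
  by rewrite mulrBl mul1r -E subrr.
by rewrite mulf_eq0 subr_eq0 eq_sym (negbTE a1).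
Qed.

End LogChar.

Definition full_order_characters (R : realType) (q : nat) : set (int -> Cplx R) :=
  [set chi | dirichlet_character q chi /\
     character_has_order q chi q.-1].

Lemma sum_full_order_characters (R : realType) (q : nat) (g : 'F_q)
  (ind : 'F_q -> nat) (omega : Cplx R) (F : (int -> Cplx R) -> Cplx R) :
  prime q -> q.-1.-primitive_root g -> (forall x, x != 0 -> g ^+ ind x = x) ->
  q.-1.-primitive_root omega ->
  \sum_(chi \in @full_order_characters R q) F chi =
  \sum_(0 <= j < q.-1 | coprime j q.-1) F (log_char ind (omega ^+ j)).
Proof.
move=> pq gP indP oP; pose P j := (j < q.-1)%N && coprime j q.-1.
have oQ j : (omega ^+ j) ^+ q.-1 = 1.
  by rewrite -exprM mulnC exprM (prim_expr_order oP) expr1n.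
have -> : @full_order_characters R q = [set log_char ind (omega ^+ j) | j in [set` P]].
  apply/seteqP; split => [chi [chiD chiO]|_ [j /andP[jQ jc] <-]].
    have [a aQ chiE] := character_log_char pq gP indP chiD.
    have [j aE] := prim_rootP oP aQ; exists (j : nat); last by rewrite -aE chiE.
    suff Pj : P j by exact: Pj.
    rewrite /P ltn_ord /= -(prim_root_exp_coprime _ oP) -aE.
    by apply/(log_char_order pq gP indP aQ); rewrite -chiE.
  have h1 := log_char_character pq gP indP (oQ j).
  split; first exact: h1.
  by apply/(log_char_order pq gP indP (oQ j)); rewrite (prim_root_exp_coprime _ oP).
rewrite fsbig_image => [|i j]; last first.
  rewrite !inE => /andP[iQ _] /andP[jQ _].
  move=> /(log_char_inj pq gP indP (oQ i) (oQ j)) /eqP.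
  by rewrite (eq_prim_root_expr oP) !modn_small // => /eqP.
rewrite -(@bigfs _ _ _ _ (index_iota 0 q.-1) P) ?iota_uniq //; last first.
  by move=> j /andP[jQ _]; rewrite mem_index_iota jQ.
rewrite [LHS]big_seq_cond [RHS]big_seq_cond; apply: eq_bigl => j.
by rewrite /P mem_index_iota /=; case: ltnP.
Qed.

Definition character_average (R : realType) (q : nat) (ind : 'F_q -> nat) (omega : Cplx R)
  (n : nat) : Cplx R :=
  (totient q.-1)%:R^-1 *
    \sum_(0 <= j < q.-1 | coprime j q.-1) log_char ind (omega ^+ j) n%:Z.

Lemma average_series (R : realType) (q : nat) : prime q -> (2 < q)%N ->
  exists c : nat -> Cplx R, [/\
    ccvg (series (fun n => c n.+1 * cpow (2^-1 : R)%:C n))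
      ((totient q.-1)%:R^-1 *
         \sum_(chi \in @full_order_characters R q) dirichlet_L q chi (2^-1 : Cplx R)),
    c 1%N = 1,
    mean_zero q (fun n => c n.+1) &
    forall n, c n = 0 \/ exists k, [/\ (0 < k)%N, (k %| q.-1)%N, n ^ k = 1 %[mod q] &
      cmod (c n) * (totient k)%:R <= 1]].
Proof.
move=> pq q2; have [g gP] := Fp_prim_root_exists pq.
have [ind indP] := Fp_log_exists pq gP.
have Q1 : (1 < q.-1)%N by lia.
have Q0 : (0 < q.-1)%N by lia.
have q0 : (0 < q)%N by lia.
have [omega oP] := prim_root_exists R Q0.
have oQ j : (omega ^+ j) ^+ q.-1 = 1.
  by rewrite -exprM mulnC exprM (prim_expr_order oP) expr1n.
have o1 j : coprime j q.-1 -> omega ^+ j != 1.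
  move=> jc; rewrite -(prim_order_dvd oP); apply/negP => /gcdn_idPr.
  by move: jc; rewrite /coprime => /eqP -> E; move: Q1; rewrite -E.
have phi0 : (totient q.-1)%:R != 0 :> Cplx R by rewrite pnatr_eq0 -lt0n totient_gt0.
have mz j : coprime j q.-1 -> mean_zero q (fun n => log_char ind (omega ^+ j) n.+1%:Z).
  by move=> jc; apply: (log_char_mean_zero pq gP indP (oQ j) (o1 j jc)).
exists (character_average ind omega); split.
- rewrite (sum_full_order_characters _ pq gP indP oP) /character_average.
  have h2 : (2^-1 : Cplx R) = (2^-1 : R)%:C by rewrite fmorphV rmorph_nat.
  pose r := [seq j <- index_iota 0 q.-1 | coprime j q.-1].
  pose F j := if coprime j q.-1 then dirichlet_L q (log_char ind (omega ^+ j)) (2^-1 : R)%:C else 0.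
  pose u j : nat -> Cplx R := if coprime j q.-1 then
     series (fun n => log_char ind (omega ^+ j) n.+1%:Z * cpow (2^-1 : R)%:C n) else fun=> 0.
  have uF j : ccvg (u j) (F j).
    rewrite /u /F; case: (boolP (coprime j q.-1)) => jc; last exact: ccvg_cst.
    apply: dirichlet_L_cvg => //.
      rewrite -(log_char_principal R pq ind) => /(log_char_inj pq gP indP (oQ j) (expr1n _ _)).
      by apply/eqP; exact: o1.
    exact: mz.
  have := ccvg_mull (c := (totient q.-1)%:R^-1) (@ccvg_sum R nat r u F uF).
  congr ccvg.
    apply/funext => N; rewrite /series /=.
    under [RHS]eq_bigr => n _ do rewrite -mulrA mulr_suml.
    rewrite -mulr_sumr; congr (_ * _); rewrite exchange_big /= big_filter.
    by apply: eq_bigr => j jc; rewrite /u jc.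
  congr (_ * _); rewrite big_filter h2; apply: eq_bigr => j jc.
  by rewrite /F jc.
- rewrite /character_average (eq_bigr (fun=> 1)) => [|j _].
    suff -> : \sum_(0 <= j < q.-1 | coprime j q.-1) 1 = (totient q.-1)%:R :> Cplx R.
      exact: mulVf.
    rewrite totient_count_coprime big_mkcond natr_sum; apply: eq_bigr => j _.
    by rewrite coprime_sym; case: coprime.
  by rewrite (log_char_expr pq gP indP (i := 0%N)) ?expr0 // rmorph1.
- split=> [n|].
    congr (_ * _); apply: eq_bigr => j jc; have [h _] := mz j jc; exact: h.
  rewrite /character_average -mulr_sumr exchange_big /= big1 ?mulr0 // => j jc.
  by have [_] := mz j jc.
move=> n; have [n0|n0] := eqVneq (n%:R : 'F_q) 0; [left|right].
  by rewrite /character_average big1 ?mulr0 // => j _; rewrite /log_char [n%:~R]n0 eqxx.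
set i := ind n%:R; pose z := omega ^+ i.
have zQ : z ^+ q.-1 = 1 by exact: oQ.
have [k kP kQ] := prim_order_exists Q0 zQ.
exists k; split=> //; first exact: prim_order_gt0 kP.
  apply/eqP; rewrite -(Fp_nat_eq _ _ pq) natrX -(indP _ n0) -exprM.
  rewrite -(prim_order_dvd gP) (prim_order_dvd oP) exprM.
  by apply/eqP; exact: prim_expr_order.
have cE : character_average ind omega n = (totient q.-1)%:R^-1 * ramanujan_sum q.-1 z.
  congr (_ * _); apply: eq_bigr => j _.
  by rewrite (log_char_expr pq gP indP (i := i)) ?indP // /z -!exprM mulnC.
have := norm_ramanujan_sum Q0 kQ kP; rewrite cE cmodM cmodV cmod_nat -mulrA.
rewrite ler_pdivrMl ?ltr0n ?totient_gt0 // mulr1 cmodE => h.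
rewrite -lecR rmorphM /= !rmorph_nat; exact: h.
Qed.

(** * Estimates *)

(* n^a for n >= 1; [ln 0 = 0] makes the value at n = 0 equal to 1. *)
Definition npow (R : realType) (a : R) (n : nat) : R := expR (a * ln n%:R).

Lemma npow_ge0 (R : realType) (a : R) n : 0 <= npow a n.
Proof. exact: expR_ge0. Qed.

Lemma npowD (R : realType) (a b : R) n : npow (a + b) n = npow a n * npow b n.
Proof. by rewrite /npow mulrDl expRD. Qed.

Lemma npowM (R : realType) (a : R) m n : (0 < m)%N -> (0 < n)%N ->
  npow a (m * n) = npow a m * npow a n.
Proof. by move=> m0 n0; rewrite /npow natrM lnM ?posrE ?ltr0n // mulrDr expRD. Qed.

Lemma npow_nat (R : realType) (k n : nat) : (0 < n)%N -> npow k%:R n = n%:R ^+ k :> R.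
Proof. by move=> n0; rewrite /npow expRM_natl lnK // posrE ltr0n. Qed.

Lemma npow1 (R : realType) n : (0 < n)%N -> npow 1 n = n%:R :> R.
Proof. by move=> n0; rewrite -[1]/(1%:R) npow_nat // expr1. Qed.

Lemma ln_nat_ge0 (R : realType) (n : nat) : 0 <= ln n%:R :> R.
Proof. by case: n => [|n]; [rewrite ln0|rewrite ln_ge0 // ler1n]. Qed.

Lemma ler_npow (R : realType) (a b : R) n : a <= b -> npow a n <= npow b n.
Proof. by move=> ab; rewrite ler_expR ler_wpM2r // ln_nat_ge0. Qed.

Lemma ler_npow2 (R : realType) (a : R) m n : 0 <= a -> (0 < m)%N -> (m <= n)%N ->
  npow a m <= npow a n.
Proof.
move=> a0 m0 mn; rewrite ler_expR ler_wpM2l // ler_ln ?posrE ?ltr0n ?ler_nat //.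
exact: leq_trans mn.
Qed.

Lemma divisors_npow_bound (R : realType) (m : nat) : (0 < m)%N ->
  exists2 K : R, 1 <= K & forall N, (0 < N)%N ->
    (size (divisors N))%:R <= K * npow (m%:R^-1) N.
Proof.
move=> m0; have [K K0 hK] := size_divisors_bound m0.
exists (npow (m%:R^-1) K) => [|N N0].
  by rewrite -(expR0) ler_expR mulr_ge0 ?invr_ge0 // ln_nat_ge0.
rewrite -npowM //; set t := size _.
have t0 : (0 < t)%N.
  by rewrite /t lt0n size_eq0; apply/eqP => E; have := divisor1 N; rewrite E.
have mR : (0 : R) < m%:R by rewrite ltr0n.
rewrite -[leLHS]lnK ?posrE ?ltr0n // ler_expR mulrC ler_pdivlMr //.
have h : ln ((t ^ m)%:R : R) <= ln (K * N)%:R.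
  by rewrite ler_ln ?posrE ?ltr0n ?muln_gt0 ?expn_gt0 ?t0 ?K0 // ler_nat; exact: hK.
by move: h; rewrite natrX lnXn ?ltr0n // -[X in X <= _ -> _]mulr_natr.
Qed.

Lemma inv_totient_bound (R : realType) (m : nat) : (0 < m)%N ->
  exists2 K : R, 1 <= K & (forall N, (0 < N)%N ->
    (size (divisors N))%:R <= K * npow (m%:R^-1) N) /\
   (forall k, (0 < k)%N -> (totient k)%:R^-1 <= K * npow (m%:R^-1 - 1) k).
Proof.
move=> m0; have [K K1 hK] := divisors_npow_bound R m0; exists K => //; split=> // k k0.
have t0 : (0 : R) < (totient k)%:R by rewrite ltr0n totient_gt0.
rewrite -[leLHS]mul1r ler_pdivrMr // npowD.
have -> : npow (-1) k = k%:R^-1 :> R by rewrite /npow mulN1r expRN lnK // posrE ltr0n.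
rewrite mulrA mulrAC ler_pdivlMr ?ltr0n // mul1r.
apply: (@le_trans _ _ ((totient k)%:R * (size (divisors k))%:R)).
  by rewrite -natrM ler_nat leq_totient_divisors.
by rewrite mulrC ler_wpM2r // hK.
Qed.

Lemma sum_roots_le (R : realType) (q k : nat) : prime q -> (0 < k)%N ->
  \sum_(0 <= n < q) (n ^ k == 1 %[mod q])%:R <= k%:R :> R.
Proof.
move=> pq k0; rewrite -natr_sum ler_nat.
pose s := [seq n%:R : 'F_q | n <- index_iota 0 q & (n ^ k == 1 %[mod q])%N].
have -> : (\sum_(0 <= n < q) (n ^ k == 1 %[mod q]) = size s)%N.
  by rewrite size_map size_filter -sum1_count [RHS]big_mkcond /=; apply: eq_bigr => n _; case: eqP.
apply: max_unity_roots => //.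
  apply/allP => x /mapP[n]; rewrite mem_filter => /andP[nk _] ->.
  by rewrite unity_rootE; rewrite -(Fp_nat_eq _ _ pq) natrX in nk.
rewrite map_inj_in_uniq ?filter_uniq ?iota_uniq // => i j.
rewrite !mem_filter !mem_index_iota /= => /andP[_ iq] /andP[_ jq] /eqP.
by rewrite Fp_nat_eq // !modn_small // => /eqP.
Qed.

Lemma mean_zero_partial_sum (R : realType) (q : nat) (f : nat -> Cplx R) (d : nat) :
  (0 < q)%N -> mean_zero q f ->
  cmod (\sum_(0 <= j < d) f j) <= \sum_(0 <= j < q) cmod (f j).
Proof.
move=> q0 [fq f0]; elim/ltn_ind: d => d IH; have [dq|qd] := ltnP d q.
  rewrite (le_trans (cmod_sum _ _ _)) // (big_cat_nat (leq0n d) (ltnW dq)) /=.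
  by rewrite lerDl; apply: sumr_ge0 => j _; exact: cmod_ge0.
rewrite (big_cat_nat (leq0n q) qd) /= f0 add0r -{1}[q]add0n big_addn.
under eq_bigr => j _ do rewrite fq.
by apply: IH; rewrite ltn_subrL q0 (leq_trans q0).
Qed.

Lemma abel_inequality (R : realType) (a : nat -> Cplx R) (b : nat -> R) (S : R) (N : nat) :
  (forall n, b n.+1 <= b n) -> (forall n, 0 <= b n) ->
  (forall d, cmod (\sum_(0 <= j < d) a j) <= S) ->
  cmod (\sum_(0 <= j < N) a j * (b j)%:C) <= S * b 0%N.
Proof.
move=> bd b0 aS.
have E : \sum_(0 <= j < N) a j * (b j)%:C = (\sum_(0 <= j < N) a j) * (b N)%:C +
    \sum_(0 <= i < N) (\sum_(0 <= j < i.+1) a j) * (b i - b i.+1)%:C.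
  elim: N => [|N IH]; first by rewrite !big_geq // mul0r addr0.
  by rewrite !(big_nat_recr N) //= IH rmorphB /=; ring.
rewrite E (le_trans (cmodD _ _)) // cmodM cmod_real ger0_norm //.
have -> : S * b 0%N = S * b N + \sum_(0 <= i < N) S * (b i - b i.+1).
  rewrite -mulr_sumr -mulrDr; congr (_ * _).
  by rewrite (@telescope_sumr_eq _ 0 N (fun i => - b i)) //; [ring|move=> i _; ring].
apply: lerD; first by rewrite ler_wpM2r.
rewrite (le_trans (cmod_sum _ _ _)) //; apply: ler_sum => i _.
rewrite cmodM cmod_real ger0_norm ?subr_ge0 // ler_wpM2r ?subr_ge0 //.
Qed.

Definition small_root (q k n : nat) : bool :=
  [&& (0 < n)%N, (n ^ 2 < q)%N & n ^ k == 1 %[mod q]].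

Lemma count_factorizations (B N : nat) : (0 < N)%N ->
  (\sum_(0 <= n < B) \sum_(0 <= m < B) [&& 0 < n, 0 < m & n * m == N] <=
    size (divisors N))%N.
Proof.
move=> N0; apply: (@leq_trans (\sum_(0 <= n < B) (n %| N))).
  apply: leq_sum => n _; have [nN|nN] := boolP (n %| N)%N; last first.
    rewrite big1 // => m _; case: (eqVneq (n * m)%N N) => [E|]; last by rewrite !andbF.
    by move: nN; rewrite -E dvdn_mulr.
  have [n0|n0] := posnP n; first by rewrite n0 big1.
  apply: (@leq_trans (\sum_(0 <= m < B) (m == N %/ n))).
    apply: leq_sum => m _; case: (eqVneq (n * m)%N N) => [E|]; last by rewrite !andbF.
    by rewrite -E mulKn // eqxx; case: ((_ && _)).
  have := count_uniq_mem (N %/ n)%N (iota_uniq 0 B).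
  rewrite -sum1_count big_mkcond /= /index_iota subn0 => h.
  apply: (@leq_trans (N %/ n \in iota 0 B)%N); last by case: (_ \in _).
  by rewrite -h; apply: leq_sum => m _; case: eqP.
rewrite (_ : (\sum_(0 <= n < B) (n %| N) = size [seq n <- index_iota 0 B | n %| N])%N); last first.
  by rewrite size_filter -sum1_count [RHS]big_mkcond /=; apply: eq_bigr => n _; case: ifP.
apply: uniq_leq_size => [|n]; first by rewrite filter_uniq // iota_uniq.
by rewrite mem_filter => /andP[nN _]; rewrite -dvdn_divisors.
Qed.

(* Products of two small roots are again roots below q, of which there are at
   most k; each arises from at most d(N) pairs. *)
Lemma sum_small_roots_le (R : realType) (K e : R) (q k B : nat) :
  1 <= K -> (forall N, (0 < N)%N -> (size (divisors N))%:R <= K * npow e N) ->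
  prime q -> (0 < k)%N ->
  \sum_(0 <= n < B) (if small_root q k n then npow (- e) n else 0) <= K * npow 2^-1 k.
Proof.
move=> K1 hK pq k0; set S := \sum_(0 <= n < B) _.
have K0 : 0 <= K by apply: le_trans K1.
have S0 : 0 <= S by apply: sumr_ge0 => n _; case: ifP => // _; exact: npow_ge0.
suff SS : S * S <= K * k%:R.
  have kE : npow 2^-1 k * npow 2^-1 k = k%:R :> R.
    by rewrite -npowD -[X in _ = X]npow1 //; congr npow; field.
  rewrite -(ler_pXn2r (n := 2)) // ?nnegrE ?mulr_ge0 ?npow_ge0 //.
  rewrite !expr2 mulrACA kE; apply: (le_trans SS).
  by rewrite ler_wpM2r // ler_peMl.
pose h N := if (0 < N)%N && (N ^ k == 1 %[mod q]) then npow (- e) N else 0 : R.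
have h0 N : 0 <= h N by rewrite /h; case: ifP => // _; exact: npow_ge0.
apply: (@le_trans _ _ (\sum_(0 <= n < B) \sum_(0 <= m < B) \sum_(0 <= N < q)
    [&& 0 < n, 0 < m & n * m == N]%N%:R * h N)).
  rewrite /S mulr_suml; apply: ler_sum => n _; rewrite mulr_sumr; apply: ler_sum => m _.
  have rhs0 : 0 <= \sum_(0 <= N < q) [&& 0 < n, 0 < m & n * m == N]%N%:R * h N.
    by apply: sumr_ge0 => N _; rewrite mulr_ge0.
  case: ifP => [/and3P[n0 nq /eqP nk]|_]; last by rewrite mul0r.
  case: ifP => [/and3P[m0 mq /eqP mk]|_]; last by rewrite mulr0.
  have nmq : (n * m < q)%N by case: (leqP n m) => nm; nia.
  rewrite (bigD1_seq (n * m)%N) ?iota_uniq ?mem_index_iota //= n0 m0 eqxx mul1r.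
  rewrite -npowM // {1}/h muln_gt0 n0 m0 expnMn -modnMml nk modnMml mul1n mk eqxx /=.
  by rewrite lerDl; apply: sumr_ge0 => N _; rewrite mulr_ge0.
have -> : \sum_(0 <= n < B) \sum_(0 <= m < B) \sum_(0 <= N < q)
    [&& 0 < n, 0 < m & n * m == N]%N%:R * h N =
  \sum_(0 <= N < q) (\sum_(0 <= n < B) \sum_(0 <= m < B) [&& 0 < n, 0 < m & n * m == N])%N%:R * h N.
  under eq_bigr => n _ do rewrite exchange_big /=.
  rewrite exchange_big /=; apply: eq_bigr => N _.
  rewrite natr_sum mulr_suml; apply: eq_bigr => n _.
  by rewrite natr_sum mulr_suml.
apply: (@le_trans _ _ (\sum_(0 <= N < q) K * (N ^ k == 1 %[mod q])%:R)); last first.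
  by rewrite -mulr_sumr ler_wpM2l // sum_roots_le.
apply: ler_sum => N _; rewrite /h; case: ifP => [/andP[N0 ->]|_]; last first.
  by rewrite mulr0 mulr_ge0.
rewrite mulr1; apply: (@le_trans _ _ ((size (divisors N))%:R * npow (- e) N)).
  by rewrite ler_wpM2r ?npow_ge0 // ler_nat count_factorizations.
apply: (@le_trans _ _ (K * npow e N * npow (- e) N)); first by rewrite ler_wpM2r ?npow_ge0 // hK.
by rewrite -mulrA -npowD subrr /npow mul0r expR0 mulr1.
Qed.

Lemma ln_le_id (R : realType) (x : R) : 0 < x -> ln x <= x.
Proof.
move=> x0; rewrite -ler_expR lnK ?posrE //; apply: le_trans (expR_ge1Dx _).
by rewrite lerDr.
Qed.

(* The loss (k ln n / ln q)^(1/32) >= 1 produces the saving; the two summands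
   correspond to k >= n^(5/8) and k < n^(5/8). *)
Lemma small_term_le (R : realType) (q n k : nat) : (2 < q)%N -> (1 < n)%N -> (0 < k)%N ->
  (q <= n ^ k)%N ->
  npow (16^-1 - 1) k * npow (- 2^-1) n <=
    expR (- (32^-1) * ln (ln q%:R)) *
      (npow (- (33 / 32)) n + npow (- (16^-1)) n * npow (- (49 / 32)) k) :> R.
Proof.
move=> q2 n1 k0 qn.
have lq0 : 0 < ln q%:R :> R by rewrite ln_gt0 // ltr1n; lia.
have ln0 : 0 < ln n%:R :> R by rewrite ln_gt0 // ltr1n.
have lk0 : 0 <= ln k%:R :> R by exact: ln_nat_ge0.
have q0 : (0 < q)%N by lia.
have lq : ln (ln q%:R) <= ln k%:R + ln n%:R :> R.
  have h1 : ln q%:R <= k%:R * ln n%:R :> R.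
    rewrite mulr_natl -lnXn ?ltr0n ?(ltn_trans _ n1) // -natrX.
    by rewrite ler_ln ?posrE ?ltr0n ?ler_nat // (leq_trans q0).
  apply: (@le_trans _ _ (ln (k%:R * ln n%:R))).
    by rewrite ler_ln ?posrE // mulr_gt0 // ltr0n.
  by rewrite lnM ?posrE ?ltr0n // lerD2l ln_le_id.
rewrite /npow mulrDr -!expRD; move: lq ln0 lk0.
move: (ln (ln q%:R)) (ln n%:R) (ln k%:R) => LQ LN LK lq ln0 lk0.
have [h|h] := lerP (5 / 8 * LN) LK.
  rewrite -[leLHS]addr0; apply: lerD; rewrite ?expR_ge0 // ler_expR; lra.
rewrite -[leLHS]add0r; apply: lerD; rewrite ?expR_ge0 // ler_expR; lra.
Qed.

Lemma sum_coef_le (R : realType) (K e : R) (q : nat) (c : nat -> Cplx R) :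
  prime q -> (2 < q)%N -> 1 <= K -> 0 <= e ->
  (forall N, (0 < N)%N -> (size (divisors N))%:R <= K * npow e N) ->
  (forall k, (0 < k)%N -> (totient k)%:R^-1 <= K * npow (e - 1) k) ->
  (forall n, c n = 0 \/ exists k, [/\ (0 < k)%N, (k %| q.-1)%N, n ^ k = 1 %[mod q] &
      cmod (c n) * (totient k)%:R <= 1]) ->
  \sum_(0 <= i < q) cmod (c i.+1) <= K ^+ 2 * npow (2 * e) q.
Proof.
move=> pq q2 K1 e0 hd ht hc; have K0 : 0 <= K by apply: le_trans K1.
have Q0 : (0 < q.-1)%N by lia.
pose D := divisors q.-1.
have kD k : k \in D -> (0 < k)%N /\ (k <= q)%N.
  rewrite -dvdn_divisors // => kQ; split; first exact: dvdn_gt0 kQ.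
  by apply: leq_trans (dvdn_leq Q0 kQ) _; rewrite leq_pred.
pose T k n := (n ^ k == 1 %[mod q])%N%:R * (K * npow (e - 1) k) : R.
have T0 k n : 0 <= T k n by rewrite !mulr_ge0 // npow_ge0.
have cT n : cmod (c n) <= \sum_(k <- D) T k n.
  case: (hc n) => [->|[k [k0 kQ nk ck]]].
    by rewrite cmod0; apply: sumr_ge0 => k _.
  rewrite (bigD1_seq k) ?divisors_uniq // -?dvdn_divisors //=.
  rewrite -[leLHS]addr0; apply: lerD; last by apply: sumr_ge0 => j _.
  rewrite /T nk eqxx mul1r; apply: le_trans (ht k k0).
  by rewrite -[leRHS]mul1r ler_pdivlMr // ltr0n totient_gt0.
apply: (@le_trans _ _ (\sum_(0 <= i < q) \sum_(k <- D) T k i.+1)); first by apply: ler_sum => i _.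
rewrite exchange_big /=.
apply: (@le_trans _ _ (\sum_(k <- D) K * npow e q)).
  rewrite [leLHS]big_seq [leRHS]big_seq; apply: ler_sum => k /kD[k0 kq].
  rewrite -mulr_suml.
  have -> : \sum_(0 <= i < q) (i.+1 ^ k == 1 %[mod q])%N%:R =
      \sum_(0 <= i < q) (i ^ k == 1 %[mod q])%N%:R :> R.
    rewrite -(@sum_periodic_shift _ q 1%N (fun i => (i ^ k == 1 %[mod q])%N%:R : R)).
      by apply: eq_bigr => i _; rewrite addn1.
    by move=> j; rewrite -modnXm modnDr modnXm.
  apply: (@le_trans _ _ (k%:R * (K * npow (e - 1) k))).
    by rewrite ler_wpM2r ?sum_roots_le // mulr_ge0 // npow_ge0.
  rewrite mulrCA ler_wpM2l // -(npow1 _ k0) -npowD addrC subrK.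
  exact: ler_npow2.
rewrite big_const_seq count_predT iter_addr_0 -[leLHS]mulr_natl.
apply: (@le_trans _ _ (K * npow e q * (K * npow e q))).
  rewrite ler_wpM2r ?mulr_ge0 ?npow_ge0 // (le_trans (hd _ Q0)) // ler_wpM2l //.
  by apply: ler_npow2 => //; rewrite leq_pred.
by rewrite mulrACA -npowD -expr2 mulr_natl mulr2n.
Qed.

Lemma cpow_half (R : realType) (i : nat) :
  cpow (2^-1 : R)%:C i = (npow (- 2^-1) i.+1)%:C :> Cplx R.
Proof. by rewrite /cpow -rmorphN -rmorphM cexp_real. Qed.

Lemma npow_split (R : realType) (n : nat) :
  npow 2^-1 n * npow (- (49 / 32)) n = npow (- (33 / 32)) n :> R.
Proof. by rewrite -npowD; have -> : 2^-1 + - (49 / 32) = - (33 / 32) :> R by field. Qed.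

Lemma sum_npow_le (R : realType) (N : nat) :
  \sum_(0 <= i < N) npow (- (33 / 32)) i.+1 <= 33 :> R.
Proof.
apply: le_trans (pseries_le N (_ : 1 < 33 / 32)) _; first by lra.
by rewrite le_eqVlt; apply/orP; left; apply/eqP; field.
Qed.

Lemma leq_exp_of_root (q n k : nat) : (1 < q)%N -> (1 < n)%N -> (0 < k)%N ->
  n ^ k = 1 %[mod q] -> (q <= n ^ k)%N.
Proof.
move=> q1 n1 k0 nk; rewrite leqNgt; apply/negP => lt.
move: nk; rewrite !modn_small // => E; have := ltn_expl k n1.
by rewrite E; case: k k0 {E lt}.
Qed.

Lemma average_series_bound (R : realType) : exists2 C : R, 0 <= C &
  forall (q : nat) (c : nat -> Cplx R), prime q -> (2 < q)%N ->
    c 1%N = 1 -> mean_zero q (fun n => c n.+1) ->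
    (forall n, c n = 0 \/ exists k, [/\ (0 < k)%N, (k %| q.-1)%N, n ^ k = 1 %[mod q] &
      cmod (c n) * (totient k)%:R <= 1]) ->
    forall N, cmod (\sum_(0 <= i < q.-1 + N) c i.+1 * cpow (2^-1 : R)%:C i - 1) <=
      C * expR (- (32^-1) * ln (ln q%:R)).
Proof.
have [K K1 [hd ht]] := inv_totient_bound R (isT : 0 < 16)%N.
have K0 : 0 <= K by apply: le_trans K1.
exists (K * (33 + K * 33) + K ^+ 2 + K ^+ 2);
  first by rewrite !addr_ge0 ?mulr_ge0 // addr_ge0 // mulr_ge0.
move=> q c pq q2 c1 mz hc N.
pose e : R := 16^-1.
have e0 : 0 <= e by rewrite invr_ge0.
have q0 : (0 < q)%N by lia.
have q1 : (1 < q)%N by lia.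
have Q0 : (0 < q.-1)%N by lia.
have V := sum_coef_le pq q2 K1 e0 hd ht hc.
set E := expR _.
have E0 : 0 <= E by exact: expR_ge0.
have lq0 : 0 < ln q%:R :> R by rewrite ln_gt0 // ltr1n.
have decay : npow (2 * e) q * npow (- 4^-1) q <= E.
  rewrite -npowD ler_expR; have := ln_le_id lq0.
  by move: lq0; rewrite /e; set x := ln (q%:R : R); set y := ln x; lra.
pose w i : R := npow (- 2^-1) i.+1.
have wS i : w i.+1 <= w i.
  rewrite ler_expR !mulNr lerN2 ler_wpM2l ?invr_ge0 //.
  by rewrite ler_ln ?posrE ?ltr0n // ler_nat.
have w0 i : 0 <= w i by exact: npow_ge0.
have term i : c i.+1 * cpow (2^-1 : R)%:C i = c i.+1 * (w i)%:C by rewrite cpow_half.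
pose T i : R := \sum_(0 <= j < q) (if small_root q j.+1 i.+1
   then npow (- e) i.+1 else 0) * npow (- (49 / 32)) j.+1.
have T0 i : 0 <= T i.
  by apply: sumr_ge0 => j _; rewrite mulr_ge0 ?npow_ge0 //; case: ifP => // _; exact: npow_ge0.
have head i : (0 < i)%N -> cmod (c i.+1) * w i <=
    K * E * (npow (- (33 / 32)) i.+1 + T i) + cmod (c i.+1) * npow (- 4^-1) q.
  move=> i0; have [iq|iq] := ltnP (i.+1 ^ 2) q; last first.
    rewrite -[leLHS]add0r; apply: lerD.
      by rewrite !mulr_ge0 // addr_ge0 // npow_ge0.
    rewrite ler_wpM2l ?cmod_ge0 // ler_expR.
    have : ln q%:R <= 2 * ln i.+1%:R :> R.
      rewrite mulr_natl -lnXn ?ltr0n // -natrX ler_ln ?posrE ?ltr0n ?ler_nat //.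
    set x := ln (q%:R : R); set y := ln (i.+1%:R : R); lra.
  rewrite -[leLHS]addr0; apply: lerD; last by rewrite mulr_ge0 ?cmod_ge0 ?npow_ge0.
  case: (hc i.+1) => [->|[k [k0 kQ nk ck]]].
    by rewrite cmod0 mul0r !mulr_ge0 // addr_ge0 // npow_ge0.
  have kq : (k.-1 < q)%N.
    apply: leq_ltn_trans (leq_pred k) _; apply: leq_ltn_trans (dvdn_leq _ kQ) _ => //.
    by rewrite ltn_predL.
  apply: (@le_trans _ _ (K * (npow (e - 1) k * npow (- 2^-1) i.+1))).
    rewrite mulrA ler_wpM2r ?npow_ge0 //; apply: le_trans (ht k k0).
    by rewrite -[leRHS]mul1r ler_pdivlMr // ltr0n totient_gt0.
  rewrite -mulrA ler_wpM2l //; have qik : (q <= i.+1 ^ k)%N by apply: leq_exp_of_root nk.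
  have := small_term_le R q2 (_ : 1 < i.+1)%N k0 qik; rewrite ltnS => /(_ i0) h.
  apply: (le_trans h); rewrite ler_wpM2l // lerD2l.
  rewrite /T (bigD1_seq k.-1) ?iota_uniq ?mem_index_iota //= prednK //.
  rewrite /small_root iq nk eqxx /= lerDl; apply: sumr_ge0 => j _.
  by rewrite mulr_ge0 ?npow_ge0 //; case: ifP => // _; exact: npow_ge0.
have sumT : \sum_(0 <= i < q) T i <= K * 33.
  rewrite exchange_big /=.
  apply: (@le_trans _ _ (\sum_(0 <= j < q) K * npow (- (33 / 32)) j.+1)); last first.
    by rewrite -mulr_sumr ler_wpM2l // sum_npow_le.
  apply: ler_sum => j _; rewrite -mulr_suml.
  have -> : K * npow (- (33 / 32)) j.+1 = K * npow 2^-1 j.+1 * npow (- (49 / 32)) j.+1.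
    by rewrite -mulrA npow_split.
  apply: ler_wpM2r; first exact: npow_ge0.
  have := @sum_small_roots_le R K e q j.+1 q.+1 K1 hd pq isT.
  by rewrite big_nat_recl //= add0r.
have tail : cmod (\sum_(0 <= j < N) c (q.-1 + j).+1 * (w (q.-1 + j)%N)%:C) <= K ^+ 2 * E.
  have mz' : mean_zero q (fun j => c (q.-1 + j).+1).
    case: mz => cq csum; split=> [n|]; first by rewrite addnA cq.
    under eq_bigr => j _ do rewrite addnC.
    by rewrite (sum_periodic_shift q.-1 cq).
  have Vs : \sum_(0 <= j < q) cmod (c (q.-1 + j).+1) = \sum_(0 <= i < q) cmod (c i.+1).
    under eq_bigr => j _ do rewrite addnC.
    rewrite (@sum_periodic_shift _ q q.-1 (fun i => cmod (c i.+1))) // => j.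
    by case: mz => cq _; rewrite cq.
  have ab := @abel_inequality R (fun j => c (q.-1 + j).+1) (fun j => w (q.-1 + j)%N)
     (K ^+ 2 * npow (2 * e) q) N.
  apply: (le_trans (ab _ _ _)) => [n|n|d|].
  - by rewrite addnS.
  - exact: w0.
  - by apply: (le_trans (mean_zero_partial_sum d q0 mz')); rewrite Vs.
  rewrite -mulrA ler_wpM2l ?exprn_ge0 //; apply: le_trans decay.
  rewrite ler_wpM2l ?npow_ge0 // addn0 /w prednK //; apply: ler_npow.
  by rewrite lerN2 lef_pV2 ?posrE // ler_nat.
have headsum : cmod (\sum_(1 <= i < q.-1) c i.+1 * (w i)%:C) <=
    K * (33 + K * 33) * E + K ^+ 2 * E.
  rewrite (le_trans (cmod_sum _ _ _)) //.
  apply: (@le_trans _ _ (\sum_(1 <= i < q.-1) (K * E * (npow (- (33 / 32)) i.+1 + T i) +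
      cmod (c i.+1) * npow (- 4^-1) q))).
    rewrite [leLHS]big_nat_cond [leRHS]big_nat_cond; apply: ler_sum => i.
    by rewrite andbT => /andP[i1 _]; rewrite cmodM cmod_real ger0_norm // head.
  apply: (@le_trans _ _ (\sum_(0 <= i < q) (K * E * (npow (- (33 / 32)) i.+1 + T i) +
      cmod (c i.+1) * npow (- 4^-1) q))).
    have pos i : 0 <= K * E * (npow (- (33 / 32)) i.+1 + T i) + cmod (c i.+1) * npow (- 4^-1) q.
      apply: addr_ge0; last by apply: mulr_ge0; [exact: cmod_ge0|exact: npow_ge0].
      apply: mulr_ge0; first exact: mulr_ge0.
      by apply: addr_ge0; [exact: npow_ge0|exact: T0].
    rewrite (big_cat_nat (isT : 0 <= 1)%N q0) /= (big_cat_nat Q0 (leq_pred q)) /=.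
    rewrite addrCA lerDl; apply: addr_ge0; first by rewrite big_nat1; exact: pos.
    by apply: sumr_ge0 => i _; exact: pos.
  rewrite big_split /= -mulr_sumr big_split /= -mulr_suml; apply: lerD.
    rewrite mulrAC ler_wpM2r // ler_wpM2l //; apply: lerD => //; exact: sum_npow_le.
  apply: (@le_trans _ _ (K ^+ 2 * npow (2 * e) q * npow (- 4^-1) q)).
    by rewrite ler_wpM2r ?npow_ge0.
  by rewrite -mulrA ler_wpM2l // exprn_ge0.
under eq_bigr => i _ do rewrite term.
rewrite (big_cat_nat (leq0n q.-1) (leq_addr N q.-1)) /=.
rewrite big_ltn // c1.
have -> : w 0%N = 1 by rewrite /w /npow ln1 mulr0 expR0.
rewrite mulr1 -[X in \sum_(X <= i < q.-1 + N) _]add0n big_addn addKn.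
under [X in cmod (_ + X - 1)]eq_bigr => j _ do rewrite addnC.
have cancel (x y : Cplx R) : 1 + x + y - 1 = x + y by ring.
rewrite cancel (le_trans (cmodD _ _)) // [leRHS]mulrDl [X in _ <= X + _]mulrDl.
exact: lerD headsum tail.
Qed.

Theorem theorem1p1 (R : realType) :
  exists delta C : R,
    [/\ 0 < delta, 0 < C &
      forall q : nat, prime q ->
        `| (totient q.-1)%:R^-1 *
             (\sum_(chi \in [set chi : int -> Cplx R |
                 dirichlet_character q chi /\
                 character_has_order q chi q.-1])
               dirichlet_L q chi (2^-1 : Cplx R))
           - 1 |
        <= (C * (ln (q%:R : R)) `^ (- delta))%:C :> Cplx R].
Proof.
have [C C0 hC] := average_series_bound R.
pose avg q : Cplx R := (totient q.-1)%:R^-1 *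
  (\sum_(chi \in [set chi : int -> Cplx R |
     dirichlet_character q chi /\ character_has_order q chi q.-1])
     dirichlet_L q chi (2^-1 : Cplx R)).
have big q : prime q -> (2 < q)%N ->
    cmod (avg q - 1) <= C * expR (- (32^-1) * ln (ln q%:R)).
  move=> pq q2; have [c [hs c1 mz hc]] := average_series R pq q2.
  have lim : ccvg (fun N => series (fun n => c n.+1 * cpow (2^-1 : R)%:C n) (N + q.-1)%N - 1)
      (avg q - 1).
    by apply: ccvgB (ccvg_cst (l := 1)); rewrite /ccvg cvg_shiftn; exact: hs.
  by apply: (cmod_cvg_le lim) => N; rewrite addnC; exact: hC.
pose C2 := cmod (avg 2%N - 1) / (ln 2%:R `^ (- (32^-1))).
have l2 : 0 < ln 2%:R `^ (- (32^-1)) :> R by rewrite powR_gt0 // ln_gt0 // ltr1n.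
have C20 : 0 <= C2 by rewrite divr_ge0 ?cmod_ge0 // ltW.
exists (32^-1), (C + C2 + 1); split.
- by rewrite invr_gt0.
- by rewrite ltr_wpDl // addr_ge0.
move=> q pq; rewrite -/(avg q) cmodE lecR.
have [q2|q2] := leqP q 2.
  have -> : q = 2%N by apply/eqP; rewrite eqn_leq q2 prime_gt1.
  have -> : cmod (avg 2%N - 1) = C2 * ln 2%:R `^ (- (32^-1)) by rewrite divfK // gt_eqF.
  by rewrite ler_pM2r // -addrA addrCA lerDl addr_ge0.
have lq0 : 0 < ln q%:R :> R by rewrite ln_gt0 // ltr1n prime_gt1.
apply: (le_trans (big q pq q2)).
have -> : expR (- (32^-1) * ln (ln q%:R)) = ln q%:R `^ (- (32^-1)) :> R.
  by rewrite /powR gt_eqF.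
by rewrite ler_wpM2r ?powR_ge0 // -addrA lerDl addr_ge0.
Qed.
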